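(* Let $1<p<\infty$ and $0<s<1$. If $\Omega\subset\mathbb{R}^N$ is an open convex cone centered at $x_0\in\mathbb{R}^N$, then for every $u\in C^\infty_0(\Omega)$ we have $$\|u\|^p_{\mathcal{X}^{s,p}_0(\Omega)}\le C\,\|u\|^p_{\mathcal{D}_0^{s,p}(\Omega)},$$ for a constant $C=C(N,p,\mathcal{E}(\Omega\cap B_1(x_0)))>0$ depending only on $N$, $p$ and the eccentricity $\mathcal{E}(\Omega\cap B_1(x_0))$. In particular, $\mathcal{X}^{s,p}_0(\Omega)=\mathcal{D}^{s,p}_0(\Omega)$.
   Context: $B_R(x_0)$ is the open ball of radius $R$ centered at $x_0$. A convex set $\Omega\subset\mathbb{R}^N$ is a convex cone centered at $x_0\in\mathbb{R}^N$ if $x_0+\tau(x-x_0)\in\Omega$ for every $x\in\Omega$ and $\tau>0$. For an open bounded set $A$, the inradius is $R_A=\sup_{x\in A}\mathrm{dist}(x,\partial A)$ and the eccentricity is $\mathcal{E}(A)=\dfrac{\mathrm{diam}(A)}{2R_A}$. $C^\infty_0(\Omega)$ is the space of smooth functions with compact support in $\Omega$ (extended by $0$ to $\mathbb{R}^N$). For $u\in C_0^\infty(\Omega)$ set $$\|u\|_{\mathcal{D}^{s,p}_0(\Omega)}:=[u]_{W^{s,p}(\mathbb{R}^N)}:=\left(\iint_{\mathbb{R}^N\times\mathbb{R}^N}\frac{|u(x)-u(y)|^p}{|x-y|^{N+sp}}\,dx\,dy\right)^{1/p},$$ and let $\mathcal{D}^{s,p}_0(\Omega)$ be the completion of $C^\infty_0(\Omega)$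 with respect to this norm. For $t>0$ and $u\in C_0^\infty(\Omega)$ the $K$-functional is $$K(t,u,L^p(\Omega),\mathcal{D}^{1,p}_0(\Omega)):=\inf_{v\in C^\infty_0(\Omega)}\Big\{\|u-v\|_{L^p(\Omega)}+t\,\|\nabla v\|_{L^p(\Omega)}\Big\},$$ and $$\|u\|_{\mathcal{X}^{s,p}_0(\Omega)}:=\left(\int_0^{+\infty}\left(\frac{K(t,u,L^p(\Omega),\mathcal{D}^{1,p}_0(\Omega))}{t^s}\right)^p\frac{dt}{t}\right)^{1/p}.$$ $\mathcal{X}^{s,p}_0(\Omega)$ is the completion of $C_0^\infty(\Omega)$ with respect to this norm. The equality $\mathcal{X}^{s,p}_0(\Omega)=\mathcal{D}^{s,p}_0(\Omega)$ means that the two norms are equivalent on $C^\infty_0(\Omega)$, so that the completions coincide. *)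

(* Defs.v *)
From HB Require Import structures.
From mathcomp Require Import all_boot all_order all_algebra.
From mathcomp Require Import all_classical all_reals all_analysis.
Set Implicit Arguments.
Unset Strict Implicit.
Unset Printing Implicit Defensive.
Import Order.TTheory GRing.Theory Num.Theory.
Import numFieldNormedType.Exports.
Local Open Scope classical_set_scope.
Local Open Scope ring_scope.

Definition rV_display : measure_display -> measure_display.
Proof. exact. Qed.

Section measurable_rV.
Context {d} {T : measurableType d} (n : nat).

Let coord (i : 'I_n) (v : 'rV[T]_n) : T := v ord0 i.

Let rV_set0 : g_sigma_preimage coord set0.
Proof. exact: sigma_algebra0. Qed.

Let rV_setC A : g_sigma_preimage coord A -> g_sigma_preimage coord (~` A).
Proof. exact: sigma_algebraC. Qed.

Let rV_bigcup (F : _^nat) : (forall i, g_sigma_preimage coord (F i)) ->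
  g_sigma_preimage coord (\bigcup_i (F i)).
Proof. exact: sigma_algebra_bigcup. Qed.

(* The product sigma-algebra, generated by the coordinates; for [T] the reals
   it is the Borel sigma-algebra of the topology of ['rV[T]_n]. *)
HB.instance Definition _ := @isMeasurable.Build (rV_display d)
  'rV[T]_n (g_sigma_preimage coord) rV_set0 rV_setC rV_bigcup.

Lemma measurable_rV_coord (i : 'I_n) :
  measurable_fun [set: 'rV[T]_n] (fun v : 'rV[T]_n => v ord0 i).
Proof.
move=> _ Y mY; rewrite setTI; apply: sub_sigma_algebra => /=.
rewrite -bigcup_seq/=; exists i => /=; first by rewrite mem_index_enum.
by exists Y => //; rewrite setTI.
Qed.

Lemma measurable_fun_rV d1 (T1 : measurableType d1) (f : T1 -> 'rV[T]_n) :
  (forall i, measurable_fun [set: T1] (fun x => f x ord0 i)) ->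
  measurable_fun [set: T1] f.
Proof.
move=> mf.
suff : g_sigma_preimage (fun i => coord i \o f) `<=` measurable.
  rewrite g_sigma_preimage_comp => prefS _ A mA.
  by apply: prefS; exists A.
apply: smallest_sub; first exact: sigma_algebra_measurable.
rewrite -bigcup_seq => A /= [i _ [B mB <-]].
exact: mf.
Qed.

End measurable_rV.

Section lebesgue_measure_rV.
Context {R : realType}.

Definition rV_cons n (x : R * 'rV[R]_n) : 'rV[R]_n.+1 := row_mx x.1%:M x.2.

Definition rV_uncons n (v : 'rV[R]_n.+1) : R * 'rV[R]_n :=
  (v ord0 ord0, \row_j v ord0 (lift ord0 j)).

Lemma rV_consK n : cancel (@rV_cons n) (@rV_uncons n).
Proof.
move=> [a v]; congr pair => /=.
  rewrite (_ : ord0 = lshift n ord0 :> 'I_(1 + n)); last exact/val_inj.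
  by apply: etrans (row_mxEl a%:M v ord0 ord0) _; rewrite mxE eqxx mulr1n.
apply/rowP => j; rewrite mxE.
rewrite (_ : lift ord0 j = rshift 1 j :> 'I_(1 + n)); last exact/val_inj.
exact: (row_mxEr a%:M v ord0 j).
Qed.

Lemma measurable_rV_cons n :
  measurable_fun [set: (R * 'rV[R]_n)%type] (@rV_cons n).
Proof.
apply: measurable_fun_rV => i.
case: (unliftP ord0 i) => [j ->|->].
- apply: (eq_measurable_fun (fun x : R * 'rV[R]_n => x.2 ord0 j)).
    by move=> x _; have /(congr1 snd)/= <- := rV_consK x; rewrite mxE.
  exact: (measurableT_comp (@measurable_rV_coord _ _ n j) measurable_snd).
- apply: (eq_measurable_fun fst) => //.
  by move=> x _; have /(congr1 fst)/= -> := rV_consK x.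
Qed.

Lemma measurable_rV_uncons n : measurable_fun [set: 'rV[R]_n.+1] (@rV_uncons n).
Proof.
apply/measurable_fun_pairP; split => /=; first exact: measurable_rV_coord.
apply: measurable_fun_rV => j.
apply: (eq_measurable_fun (fun v : 'rV[R]_n.+1 => v ord0 (lift ord0 j))).
  by move=> v _ /=; rewrite mxE.
exact: measurable_rV_coord.
Qed.

Section leb_cons.
Variables (n : nat) (m : {sigma_finite_measure set 'rV[R]_n -> \bar R}).

Definition leb_cons : set 'rV[R]_n.+1 -> \bar R :=
  pushforward (@lebesgue_measure R \x m)%E (@rV_cons n).

Let leb_cons0 : leb_cons set0 = 0%E.
Proof. by rewrite /leb_cons /pushforward preimage_set0 measure0. Qed.

Let leb_cons_ge0 A : (0 <= leb_cons A)%E.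
Proof. exact: (measure_ge0 (@lebesgue_measure R \x m)%E). Qed.

Let leb_cons_sigma_additive : semi_sigma_additive leb_cons.
Proof.
apply: (@measure_semi_sigma_additive _ _ _
  (pushforward (@lebesgue_measure R \x m)%E (@rV_cons n))).
exact: measurable_rV_cons.
Qed.

HB.instance Definition _ := isMeasure.Build _ _ _ leb_cons
  leb_cons0 leb_cons_ge0 leb_cons_sigma_additive.

Let leb_cons_sigma_finite : sigma_finite setT leb_cons.
Proof.
have /sigma_finiteP[F [TF ndF Foo]] := sigma_finiteT (@lebesgue_measure R).
have /sigma_finiteP[G [TG ndG Goo]] := sigma_finiteT m.
exists (fun k => @rV_uncons n @^-1` (F k `*` G k)).
  rewrite -preimage_bigcup; apply/esym/seteqP; split => // v _ /=.
  have : (\bigcup_k F k) (rV_uncons v).1 by rewrite -TF.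
  have : (\bigcup_k G k) (rV_uncons v).2 by rewrite -TG.
  move=> [k _ Gk] [l _ Fl]; exists (maxn k l) => //; split.
  - by move: Fl; exact/subsetPset/ndF/leq_maxr.
  - by move: Gk; exact/subsetPset/ndG/leq_maxl.
move=> k; have [? ?] := Foo k; have [? ?] := Goo k; split.
  rewrite -[X in measurable X]setTI; apply: measurable_rV_uncons => //.
  exact: measurableX.
rewrite /leb_cons /pushforward -comp_preimage.
rewrite (_ : _ \o _ = id); last by apply/funext => x /=; rewrite rV_consK.
by rewrite preimage_id product_measure1E// lte_mul_pinfty// ge0_fin_numE.
Qed.

HB.instance Definition _ := Measure_isSigmaFinite.Build _ _ _ leb_cons
  leb_cons_sigma_finite.

End leb_cons.

(* N-dimensional Lebesgue measure as an iterated product; on the one-point space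
   ['rV[R]_0] it is the unit mass, the neutral element for products. *)
Fixpoint leb (n : nat) : {sigma_finite_measure set 'rV[R]_n -> \bar R} :=
  if n is k.+1 then leb_cons (leb k) else \d_(0 : 'rV[R]_0).

End lebesgue_measure_rV.
Arguments leb {R} n.

Section geometry.
Context {R : realType} {N : nat}.
Implicit Types (x y v : 'rV[R]_N) (A : set 'rV[R]_N).

(* The library norm [`|v|] on ['rV[R]_N] is the maximum norm; it induces the same
   topology ([open], [closure], [compact]) but not the same balls, distances
   and diameters. *)
Definition enorm v : R := Num.sqrt (\sum_i v ord0 i ^+ 2).

Definition eball x (r : R) : set 'rV[R]_N := [set y | enorm (y - x) < r].

Definition convex_cone x A : Prop :=
  convex_set (A : set (convex_lmodType 'rV[R]_N)) /\
  forall y (tau : R), A y -> 0 < tau -> A (x + tau *: (y - x)).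

Definition boundary A : set 'rV[R]_N := closure A `\` A^°.

Definition edistance x A : R := inf [set enorm (x - y) | y in A].

Definition ediam A : R := sup [set enorm (x - y) | x in A & y in A].

Definition inradius A : R := sup [set edistance x (boundary A) | x in A].

Definition eccentricity A : R := ediam A / (2 * inradius A).

End geometry.

Section spaces.
Context {R : realType} {N : nat}.
Implicit Types (u v : 'rV[R]_N -> R) (Omega : set 'rV[R]_N).

Definition partial (i : 'I_N) u : 'rV[R]_N -> R^o :=
  fun x => 'D_(delta_mx ord0 i) (u : 'rV[R]_N -> R^o) x.

Definition grad u (x : 'rV[R]_N) : 'rV[R]_N := \row_i partial i u x.

Definition smooth u : Prop := forall l : seq 'I_N,
  let w : 'rV[R]_N -> R^o := foldr partial u l in
  continuous w /\ forall (i : 'I_N) x, derivable w x (delta_mx ord0 i).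

Definition supp u : set 'rV[R]_N := closure [set x | u x != 0].

(* Elements are functions on the whole space, vanishing off [Omega]. *)
Definition C0infty Omega : set ('rV[R]_N -> R) :=
  [set u | smooth u /\ compact (supp u) /\ supp u `<=` Omega].

Local Open Scope ereal_scope.

Definition Lp_norm Omega (p : R) (f : 'rV[R]_N -> R) : \bar R :=
  'N[leb N]_(p%:E)[(EFin \o f) \_ Omega].

(* On the diagonal the integrand is [0 / 0], which evaluates to [0]; the
   diagonal is negligible. *)
Definition D_norm (s p : R) u : \bar R :=
  (\int[(leb N \x leb N)]_z
     ((`|u z.1 - u z.2| `^ p) / (enorm (z.1 - z.2) `^ (N%:R + s * p)))%R%:E)
  `^ p^-1.

Definition K_functional (t : R) (p : R) Omega u : \bar R :=
  ereal_inf [set Lp_norm Omega p (fun x => u x - v x)%R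
                 + t%:E * Lp_norm Omega p (fun x => enorm (grad v x))
            | v in C0infty Omega].

Definition X_norm (s p : R) Omega u : \bar R :=
  (\int[lebesgue_measure]_(t in [set` `]0%R, +oo[])
     ((K_functional t p Omega u * ((t `^ s)^-1)%R%:E) `^ p * (t^-1)%R%:E))
  `^ p^-1.

End spaces.

(* Equality of two abstract completions of [S], in the sense that the identity
   of [S] extends to an isomorphism between them. *)
Definition equivalent_norms (T : Type) (R : realType) (S : set T)
    (n1 n2 : T -> \bar R) : Prop :=
  exists a b : R, 0 < a /\ 0 < b /\
    forall u, S u -> (a%:E * n2 u <= n1 u)%E /\ (n1 u <= b%:E * n2 u)%E.

(* Main.v *)
Require Import Defs.
From mathcomp Require Import all_boot all_order all_algebra.
From mathcomp Require Import all_classical all_reals all_analysis.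
From mathcomp Require Import measurable_realfun ring lra.
Set Implicit Arguments.
Unset Strict Implicit.
Unset Printing Implicit Defensive.
Import Order.TTheory GRing.Theory Num.Theory.
Import numFieldNormedType.Exports.
Local Open Scope classical_set_scope.
Local Open Scope ring_scope.

(** Put [E t := \int_x \int_(|h| < t) |u (x + h) - u x| ^ p].  The integral of
    [t ^ (-N - s p - 1) E t] over [t > 0] is [D_norm ^ p / (N + s p)] by Tonelli,
    while [X_norm ^ p] is the integral of [t ^ (- s p - 1) K t ^ p]; so both
    estimates follow from the comparison of [K t ^ p] with [t ^ -N E t].
    For the lower bound of [K], any competitor [v] gives
    [||u (. + h) - u|| <= 2 ||u - v|| + C |h| ||grad v||].
    For the upper bound, take as competitor [v x := \int_h u (x + h) phi h] with
    [phi] a bump of scale [t] supported in [t c + B(0, t r / 2)], where the ball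
    [x0 - B(c, r)] lies in [Omega] and in the unit ball around [x0].  Since [Omega]
    is a convex cone, [x + h] in [Omega] and [h] in the support of [phi] force [x]
    in [Omega], so [v] is compactly supported in [Omega] and no Hardy inequality
    is needed.  The eccentricity controls [r] from below. *)

(** * Lebesgue measure on row vectors *)

(** The smoothness of [v] and the size of its gradient have different sources. Differentiation under
    the integral puts every derivative on [u], so a merely Lipschitz [phi] gives a smooth [v]. The
    size of [grad v] comes from moving a translation onto [phi], whose increments have integral
    zero, so that only the differences [u (x + h) - u x] appear. Hence [|u - v|] and [t |grad v|]
    are both bounded by one local mean of [|u (x + h) - u x|], and a single Hoelder estimate serves
    both. The support of [phi] takes half of the available radius, which leaves room for its
    translates. Two norms coexist: balls of the library are cubes, whose volume is explicit, while
    the statement is Euclidean; passing from one to the other costs factors of [N]. The eccentricity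
    enters because the part of a nonempty open cone in the unit ball has diameter at least [1 / 2]:
    a bound on the ratio of diameter to inradius is then a lower bound on the inradius itself. *)

Section rV_measurability.
Context {R : realType} {n : nat}.
Implicit Types (x y v : 'rV[R]_n) (A : set 'rV[R]_n).

Lemma rV_norm_ltP v (e : R) : 0 < e ->
  reflect (forall i, `|v ord0 i| < e) (`|v| < e).
Proof.
move=> e0; rewrite [`|v|](mx_normrE v); apply: (iffP idP).
  by move=> /bigmax_ltP[_ /= h] i; exact: (h (ord0, i)).
by move=> h; apply/bigmax_ltP; split => // -[i j] _ /=; rewrite (ord1 i).
Qed.

Lemma rV_norm_leP v (e : R) : 0 <= e ->
  reflect (forall i, `|v ord0 i| <= e) (`|v| <= e).
Proof.
move=> e0; rewrite [`|v|](mx_normrE v); apply: (iffP idP).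
  by move=> /bigmax_leP[_ /= h] i; exact: (h (ord0, i)).
by move=> h; apply/bigmax_leP; split => // -[i j] _ /=; rewrite (ord1 i).
Qed.

Lemma rV_coord_le v i : `|v ord0 i| <= `|v|.
Proof. by have /(rV_norm_leP _ (normr_ge0 _)) := lexx `|v|; exact. Qed.

Lemma measurable_rV_ball x (r : R) : measurable (ball x r).
Proof.
have [r0|r0] := ltP 0 r; last first.
  rewrite mx_norm_ball (_ : ball_ _ _ _ = set0)//.
  apply/seteqP; split => // y /=.
  by rewrite ltNge (le_trans r0).
rewrite (_ : ball x r =
    \bigcap_(i in [set` enum 'I_n]) [set y : 'rV[R]_n | ball (x ord0 i) r (y ord0 i)]).
  rewrite bigcap_seq; apply: bigsetI_measurable => i _.
  rewrite -[X in measurable X]setTI.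
  apply: (measurable_rV_coord i) => //.
  by rewrite ball_itv; exact: measurable_itv.
rewrite mx_norm_ball; apply/seteqP; split => y /=.
  move=> /(rV_norm_ltP _ r0) h i _ /=.
  by have := h i; rewrite !mxE.
move=> h; apply/(rV_norm_ltP _ r0) => i.
by rewrite !mxE; apply: (h i) => /=; rewrite mem_enum.
Qed.

(** The sigma-algebra is generated by the coordinates. An open set is the union of the cubes with
    rational centre and rational radius that it contains, and these are countably many. *)
Lemma open_measurable_rV A : open A -> measurable A.
Proof.
move=> oA.
pose q (c : 'rV[rat]_n) : 'rV[R]_n := map_mx ratr c.
pose B (c : 'rV[rat]_n * rat) := ball (q c.1) (ratr c.2).
rewrite (_ : A = \bigcup_c (if `[< B c `<=` A >] then B c else set0)); last first.
  apply/seteqP; split => [x Ax|x [c _]]; last by case: asboolP => // /[apply].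
  have /nbhs_ballP[e /= e0 eA] := open_nbhs_nbhs (conj oA Ax).
  (* With a radius below [e / 2] and a centre closer to [x] than that radius, the cube contains [x]
     and stays in the ball of radius [e]. *)
  have [s] := rat_in_itvoo (divr_gt0 e0 (@ltr0n R 2)).
  rewrite in_itv /= => /andP[s0 se].
  have /(_ _)/cid-/all_sig[c cE] : forall i,
      exists c : rat, ball (x ord0 i) (ratr s) (ratr c : R).
    move=> i; have [|c] := @rat_in_itvoo R (x ord0 i - ratr s) (x ord0 i + ratr s).
      by rewrite ltrBlDr -addrA ltrDl addr_gt0.
    by exists c; rewrite ball_itv.
  exists (\row_i c i, s) => //; case: asboolP => /=.
    move=> _; rewrite /B mx_norm_ball; apply/rV_norm_ltP => // i.
    by rewrite !mxE distrC; exact: cE.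
  case; apply: subset_trans eA => y; rewrite /B mx_norm_ball /= => qy.
  rewrite (_ : x - y = (x - q (\row_i c i)) + (q (\row_i c i) - y)).
    apply: le_lt_trans (ler_normD _ _) _; rewrite [e]splitr.
    apply: ltrD; last exact: lt_trans se.
    apply: lt_trans se; apply/rV_norm_ltP => // i.
    by rewrite !mxE; exact: cE.
  by rewrite addrA subrK.
apply: countable_bigcupT_measurable => // c.
by case: asboolP => // _; exact: measurable_rV_ball.
Qed.

Lemma continuous_measurable_rV (f : 'rV[R]_n -> R) :
  continuous f -> measurable_fun setT f.
Proof.
move=> cf; apply: (measurability _ (RGenOpens.measurableE R)) => _ [_ [a [b ->] <-]].
rewrite setTI; apply: open_measurable_rV.
by move/continuousP : cf; apply; exact: interval_open.
Qed.

Lemma measurable_rV_addr (c : 'rV[R]_n) :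
  measurable_fun setT (fun x : 'rV[R]_n => x + c).
Proof.
apply: measurable_fun_rV => i.
apply: (eq_measurable_fun (fun z : 'rV[R]_n => z ord0 i + c ord0 i)).
  by move=> z _; rewrite mxE.
by apply: measurable_funD => //; exact: measurable_rV_coord.
Qed.

Lemma measurable_rV_add d (T : measurableType d) (f g : T -> 'rV[R]_n) :
  measurable_fun setT f -> measurable_fun setT g ->
  measurable_fun setT (fun z => f z + g z).
Proof.
move=> mf mg; apply: measurable_fun_rV => i.
apply: (eq_measurable_fun (fun z => f z ord0 i + g z ord0 i)).
  by move=> z _; rewrite mxE.
by apply: measurable_funD; exact: (measurableT_comp (measurable_rV_coord i)).
Qed.

Lemma measurable_rV_sub d (T : measurableType d) (f g : T -> 'rV[R]_n) :
  measurable_fun setT f -> measurable_fun setT g ->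
  measurable_fun setT (fun z => f z - g z).
Proof.
move=> mf mg; apply: measurable_fun_rV => i.
apply: (eq_measurable_fun (fun z => f z ord0 i - g z ord0 i)).
  by move=> z _; rewrite !mxE.
by apply: measurable_funB; exact: (measurableT_comp (measurable_rV_coord i)).
Qed.

Lemma measurable_enorm : measurable_fun setT (@enorm R n).
Proof.
apply: measurableT_comp.
  by apply: continuous_measurable_fun => x; exact: sqrt_continuous.
rewrite (_ : (fun v => _) =
    fun v : 'rV[R]_n => \sum_(i <- enum 'I_n) v ord0 i ^+ 2); last first.
  by apply/funext => v; rewrite big_enum.
apply: measurable_sum => i.
by apply: measurable_funX; exact: measurable_rV_coord.
Qed.

Lemma enorm_ge0 v : 0 <= enorm v.
Proof. exact: sqrtr_ge0. Qed.

Lemma norm_le_enorm v : `|v| <= enorm v.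
Proof.
apply/rV_norm_leP => [|i]; first exact: enorm_ge0.
rewrite -sqrtr_sqr ler_sqrt ?sumr_ge0// => [|j _]; last exact: sqr_ge0.
by rewrite (bigD1 i)//= lerDl sumr_ge0// => j _; exact: sqr_ge0.
Qed.

Lemma enorm_le_norm v : enorm v <= n%:R * `|v|.
Proof.
rewrite -[leRHS]ger0_norm ?mulr_ge0//.
rewrite -sqrtr_sqr ler_sqrt ?sqr_ge0//.
apply: (@le_trans _ _ (\sum_(i < n) `|v| ^+ 2)).
  apply: ler_sum => i _; rewrite -real_normK ?num_real//.
  by rewrite lerXn2r ?nnegrE// rV_coord_le.
rewrite sumr_const card_ord exprMn -[leLHS]mulr_natl ler_wpM2r ?sqr_ge0//.
by rewrite -natrX ler_nat; case: n => // m; rewrite leq_pmulr.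
Qed.

Lemma enorm_eq0 v : enorm v = 0 -> v = 0.
Proof.
move=> v0; apply/eqP; rewrite -normr_le0.
by rewrite (le_trans (norm_le_enorm v))// v0.
Qed.

Lemma enormN v : enorm (- v) = enorm v.
Proof.
by rewrite /enorm; congr Num.sqrt; apply: eq_bigr => i _; rewrite mxE sqrrN.
Qed.

End rV_measurability.

(** * Translation invariance and the volume of cubes *)

Section leb_theory.
Context {R : realType}.
Local Open Scope ereal_scope.

(** The image of Lebesgue measure under the shift still gives half-open intervals their length, and
    this characterises Lebesgue measure. *)
Lemma ge0_integral_lebesgue_shift (c : R) (f : R -> \bar R) :
  measurable_fun setT f -> (forall x, 0 <= f x) ->
  \int[lebesgue_measure]_x f (x + c)%R = \int[lebesgue_measure]_x f x.
Proof.
move=> mf f0.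
have mc : measurable_fun [set: measurableTypeR R] (fun x : R => (x + c)%R).
  by apply: measurable_funD.
transitivity (\int[pushforward lebesgue_measure
    (fun x : measurableTypeR R => (x + c)%R : measurableTypeR R)]_x f x).
  by rewrite ge0_integral_pushforward.
apply: eq_measure_integral => /= A mA _; apply/esym.
apply: (@lebesgue_measure_unique R
  (pushforward lebesgue_measure (fun x : R => (x + c)%R : measurableTypeR R))) => //.
move=> _ [[a b]] _ <-; rewrite [RHS](_ : _ =
  lebesgue_measure ((fun x : R => x + c)%R @^-1` `]a, b]))//.
rewrite [X in _ = _ X](_ : _ = [set` `](a - c)%R, (b - c)%R]]); last first.
  by apply/seteqP; split => x /=; rewrite !in_itv/= lerBrDr ltrBlDr.
rewrite !lebesgue_measure_itv/= !lte_fin ltrD2r.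
by rewrite -!EFinD opprB addrA subrK.
Qed.

Lemma ge0_integral_leb_cons n (f : 'rV[R]_n.+1 -> \bar R) :
  measurable_fun setT f -> (forall x, 0 <= f x) ->
  \int[leb n.+1]_x f x =
  \int[lebesgue_measure]_a \int[leb n]_v f (rV_cons (a, v)).
Proof.
move=> mf f0.
have mc : measurable_fun [set: measurableTypeR R * 'rV[R]_n] (@rV_cons R n).
  exact: measurable_rV_cons.
transitivity (\int[lebesgue_measure \x leb n]_z f (rV_cons z)).
  exact: (@ge0_integral_pushforward _ _ _ _ _ _ mc
    (lebesgue_measure \x leb n)%E setT f measurableT mf (fun y _ => f0 y)).
apply: (@fubini_tonelli1 _ _ _ _ R lebesgue_measure (leb n)
    (f \o @rV_cons R n)) => // [|x]; last exact: f0.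
exact: measurableT_comp mf mc.
Qed.

Lemma rV_cons0 n (a : R) (v : 'rV[R]_n) : rV_cons (a, v) ord0 ord0 = a.
Proof. by have /(congr1 fst) := rV_consK (a, v). Qed.

Lemma rV_consS n (a : R) (v : 'rV[R]_n) j :
  rV_cons (a, v) ord0 (lift ord0 j) = v ord0 j.
Proof.
have := congr1 (fun x : R * 'rV[R]_n => x.2 ord0 j) (rV_consK (a, v)).
by rewrite /= mxE.
Qed.

Lemma rV_cons_add n (a b : R) (v w : 'rV[R]_n) :
  (rV_cons (a, v) + rV_cons (b, w) = rV_cons (a + b, v + w))%R.
Proof. by apply: etrans (add_row_mx a%:M v b%:M w) _; rewrite -raddfD. Qed.

Lemma rV_unconsK n : cancel (@rV_uncons R n) (@rV_cons R n).
Proof.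
move=> v; apply/rowP => j; rewrite /rV_uncons.
case: (unliftP ord0 j) => [i ->|->]; last by rewrite rV_cons0.
by rewrite rV_consS mxE.
Qed.

(** Induction on the dimension: after Tonelli, the first coordinate is shifted by the
    one-dimensional case and the others by the induction hypothesis. *)
Lemma ge0_integral_leb_shift n (c : 'rV[R]_n) (f : 'rV[R]_n -> \bar R) :
  measurable_fun setT f -> (forall x, 0 <= f x) ->
  \int[leb n]_x f (x + c)%R = \int[leb n]_x f x.
Proof.
elim: n c f => [c f mf f0|n ih c f mf f0].
  by apply: eq_integral => x _; congr f; apply/rowP => -[].
rewrite ge0_integral_leb_cons => [||x]; last exact: f0; last first.
  exact: (measurableT_comp mf (measurable_rV_addr c)).
rewrite ge0_integral_leb_cons => [|//|x]; last exact: f0.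
have mfc := measurableT_comp mf (@measurable_rV_cons R n).
rewrite -[RHS](@ge0_integral_lebesgue_shift (rV_uncons c).1); last 2 first.
  exact: (@measurable_fun_fubini_tonelli_F _ _ R _ _ (leb n)
    (f \o @rV_cons R n) mfc (fun x => f0 _)).
  by move=> x; exact: integral_ge0.
apply: eq_integral => a _.
rewrite -[RHS](ih (rV_uncons c).2)//; last first.
  exact: (measurableT_comp mfc (measurable_pair1 _)).
by apply: eq_integral => v _; rewrite -rV_cons_add -surjective_pairing rV_unconsK.
Qed.

(** Balls of the maximum norm are cubes of side [2 r], hence products of an interval and a cube of
    lower dimension. In dimension zero the value is the unit mass of the single point. *)
Lemma leb_ball n (x : 'rV[R]_n) (r : R) : (0 < r)%R ->
  leb n (ball x r) = ((2 * r) ^+ n)%:E.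
Proof.
move=> r0; elim: n x => [|n ih] x.
  rewrite expr0 /= diracE mem_set// mx_norm_ball.
  by apply/rV_norm_ltP => // -[].
rewrite /= /leb_cons /pushforward.
rewrite (_ : _ @^-1` _ = ball (x ord0 ord0) r `*` ball (rV_uncons x).2 r).
  rewrite product_measure1E; last 2 first.
    by rewrite ball_itv; exact: measurable_itv.
    exact: measurable_rV_ball.
  rewrite [X in (X * _)%E](_ : _ = (r *+ 2)%:E); last first.
    exact/lebesgue_measure_ball/ltW.
  rewrite ih -EFinM.
  by rewrite [in RHS]exprS mulr_natl.
have x0 a v : (x - rV_cons (a, v))%R ord0 ord0 = (x ord0 ord0 - a)%R.
  by rewrite mxE mxE rV_cons0.
have xS a v j : (x - rV_cons (a, v))%R ord0 (lift ord0 j) =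
    ((rV_uncons x).2 - v)%R ord0 j.
  by rewrite mxE mxE rV_consS !mxE.
rewrite !mx_norm_ball; apply/seteqP; split => -[a v] /=.
  move=> /(rV_norm_ltP _ r0) h; split.
    by have := h ord0; rewrite x0.
  by apply/(rV_norm_ltP _ r0) => i; have := h (lift ord0 i); rewrite xS.
move=> [/= ha hv]; apply/(rV_norm_ltP _ r0) => i.
case: (unliftP ord0 i) => [j ->|->]; last by rewrite x0.
by rewrite xS; exact/rV_norm_ltP.
Qed.

Lemma integral_leb_shift n (c : 'rV[R]_n) (f : 'rV[R]_n -> \bar R) :
  (leb n).-integrable setT f ->
  \int[leb n]_x f (x + c)%R = \int[leb n]_x f x.
Proof.
move=> intf; rewrite [LHS]integralE [RHS]integralE.
have mf : measurable_fun setT f by case/integrableP: intf.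
congr (_ - _).
- rewrite -[RHS](@ge0_integral_leb_shift n c)//; last exact: measurable_funepos.
  by apply: eq_integral => x _; rewrite !funeposE.
- rewrite -[RHS](@ge0_integral_leb_shift n c)//; last exact: measurable_funeneg.
  by apply: eq_integral => x _; rewrite !funenegE.
Qed.

Lemma integrable_leb_shift n (c : 'rV[R]_n) (f : 'rV[R]_n -> \bar R) :
  (leb n).-integrable setT f ->
  (leb n).-integrable setT (fun x => f (x + c)%R).
Proof.
move=> /integrableP[mf fi]; apply/integrableP; split.
  exact: (measurableT_comp mf (measurable_rV_addr c)).
rewrite (@ge0_integral_leb_shift n c (abse \o f)) => [//||x].
  exact: measurableT_comp.
exact: abse_ge0.
Qed.

End leb_theory.

(** * The shift energy and the fractional seminorm *)

Section powR_tail.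
Context {R : realType}.

Lemma cvgy_powRN (q : R) : 0 < q -> t `^ (- q) @[t --> +oo] --> (0 : R).
Proof.
move=> q0; apply/cvgrPdist_le => /= e e0.
exists (e `^ (- q^-1)); split; first exact: num_real.
move=> t et.
have t0 : 0 < t by apply: le_lt_trans et; exact: powR_ge0.
rewrite sub0r normrN ger0_norm ?powR_ge0// powRN.
rewrite -[leRHS]invrK lef_pV2 ?posrE ?invr_gt0 ?powR_gt0//.
rewrite (_ : e^-1 = (e `^ (- q^-1)) `^ q).
  by rewrite ge0_ler_powR ?nnegrE ?powR_ge0 ?ltW.
by rewrite -powRrM mulNr mulVf ?gt_eqF// powR_inv1// ltW.
Qed.

Lemma integral_powR_tail (a q : R) : 0 < a -> 0 < q ->
  (\int[lebesgue_measure]_(t in `]a, +oo[) (t `^ (- q - 1))%:E =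
   (q^-1 * a `^ (- q))%:E)%E.
Proof.
move=> a0 q0.
have cp r (t : R) : a <= t -> {for t, continuous (fun t : R => t `^ r)}.
  move=> at'; apply/differentiable_continuous/derivable1_diffP.
  by apply: derivable_powR; rewrite in_itv/= andbT (lt_le_trans a0).
rewrite integral_itv_obnd_cbnd; last first.
  apply/measurable_EFinP; apply: measurable_funTS.
  exact: measurable_powR.
rewrite (@ge0_continuous_FTC2y _ _ (fun t => - q^-1 * t `^ (- q)) a 0)//.
- by rewrite sub0e -EFinN mulNr opprK.
- by move=> t _; exact: powR_ge0.
- apply: derivable_within_continuous => t; rewrite in_itv/= andbT => at'.
  by apply: derivable_powR; rewrite in_itv/= andbT (lt_le_trans a0).
- rewrite -[X in _ --> X](mulr0 (- q^-1)).
  by apply: cvgM; [exact: cvg_cst|exact: cvgy_powRN].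
- move=> t at'; apply: derivableM => //.
  by apply: derivable_powR; rewrite in_itv/= andbT (lt_trans a0).
- apply: cvg_at_right_filter.
  by apply: cvgM; [exact: cvg_cst|exact: cp].
- move=> t; rewrite in_itv/= andbT => at'.
  have t0 : 0 < t by rewrite (lt_trans a0).
  rewrite derive1E deriveMl; last by apply: derivable_powR; rewrite in_itv/= t0.
  rewrite -derive1E powR_derive1 ?in_itv/= ?t0//.
  by rewrite /GRing.scale/= mulrA mulrNN mulVf ?gt_eqF// mul1r.
Qed.

End powR_tail.

Lemma measurable_fun_natrb {R : realType} d (T : measurableType d) (b : T -> bool) :
  measurable_fun setT b -> measurable_fun setT (fun x => (b x)%:R : R).
Proof.
move=> mb; rewrite (_ : (fun x => _) = \1_(b @^-1` [set true]) :> (T -> R)).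
  apply: measurable_indic; rewrite -[X in measurable X]setTI.
  exact: mb.
apply/funext => x; rewrite indicE; congr ((_ : bool)%:R).
by apply/idP/idP; rewrite inE.
Qed.

Section shift_energy.
Context {R : realType} {N : nat}.
Implicit Types (u : 'rV[R]_N -> R) (x h : 'rV[R]_N).

(** The [E t] of the overview. The constraint on [h] is a factor rather than a domain of
    integration, so that the integrand is jointly measurable in [t], [x], [h] and Tonelli applies on
    full product spaces. *)
Definition shift_energy u (p t : R) : \bar R :=
  (\int[leb N]_x \int[leb N]_h
    ((enorm h < t)%R%:R * `|u (x + h) - u x| `^ p)%:E)%E.

Lemma measurable_shift_powR d (T : measurableType d) u p (x h : T -> 'rV[R]_N) :
  measurable_fun setT u -> measurable_fun setT x -> measurable_fun setT h ->
  measurable_fun setT (fun z => `|u (x z + h z) - u (x z)| `^ p).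
Proof.
move=> mu mx mh; apply: (measurableT_comp (measurable_powR _)).
apply: measurableT_comp => //; apply: measurable_funB.
  by apply: (measurableT_comp mu); exact: measurable_rV_add.
exact: measurableT_comp.
Qed.

Lemma measurable_enorm_lt d (T : measurableType d) (h : T -> 'rV[R]_N)
    (t : T -> R) :
  measurable_fun setT h -> measurable_fun setT t ->
  measurable_fun setT (fun z => (enorm (h z) < t z)%R%:R : R).
Proof.
move=> mh mt; apply: measurable_fun_natrb; apply: measurable_fun_ltr => //.
exact: (measurableT_comp measurable_enorm).
Qed.

(** With [q = N + s p], integrating in [t] first turns the indicator of [|h| < t] into the tail
    integral of [t ^ (- q - 1)] over [t > |h|], that is [|h| ^ (- q) / q]; the substitution
    [y = x + h] then produces the kernel of [D_norm]. *)
Lemma integral_shift_energy u (p s : R) : measurable_fun setT u ->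
  0 < p -> 0 < s -> 
  (\int[lebesgue_measure]_(t in `]0%R, +oo[)
     ((t `^ (- (N%:R + s * p) - 1))%:E * shift_energy u p t) =
   ((N%:R + s * p)^-1)%:E * D_norm s p u `^ p)%E.
Proof.
move=> mu p0 s0; set q := N%:R + s * p.
have q0 : 0 < q by rewrite ltr_wpDl// mulr_gt0.
pose g x h := `|u (x + h) - u x| `^ p.
pose k t h := (enorm h < t)%R%:R * t `^ (- q - 1).
have mg d (T : measurableType d) (x h : T -> 'rV[R]_N) :
    measurable_fun setT x -> measurable_fun setT h ->
    measurable_fun setT (fun z => g (x z) (h z)).
  exact: measurable_shift_powR.
have mk d (T : measurableType d) (t : T -> R) (h : T -> 'rV[R]_N) :
    measurable_fun setT t -> measurable_fun setT h ->
    measurable_fun setT (fun z => k (t z) (h z)).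
  move=> mt mh; apply: measurable_funM; first exact: measurable_enorm_lt.
  exact: (measurableT_comp (measurable_powR _)).
have k0 t h : 0 <= k t h by rewrite mulr_ge0 ?powR_ge0.
have g0 x h : 0 <= g x h by exact: powR_ge0.
pose G (t : R) x := (\int[leb N]_h (k t h * g x h)%:E)%E.
have mkg : measurable_fun setT
    (fun w : (measurableTypeR R * 'rV[R]_N) * 'rV[R]_N =>
      (k w.1.1 w.2 * g w.1.2 w.2)%:E).
  apply/measurable_EFinP; apply: measurable_funM.
    by apply: mk => //; exact: measurableT_comp.
  by apply: mg => //; exact: measurableT_comp.
have mG : measurable_fun setT (fun z : measurableTypeR R * 'rV[R]_N => G z.1 z.2).
  apply: (measurable_fun_fubini_tonelli_F _ mkg) => w.
  by rewrite lee_fin mulr_ge0.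
have G0 t x : (0 <= G t x)%E.
  by apply: integral_ge0 => h _; rewrite lee_fin mulr_ge0.
transitivity (\int[lebesgue_measure]_t \int[leb N]_x G t x)%E.
  rewrite integral_mkcond; apply: eq_integral => t _; rewrite patchE.
  have m1 : measurable_fun setT (fun z : 'rV[R]_N * 'rV[R]_N =>
      ((enorm z.2 < t)%R%:R * g z.1 z.2)%:E).
    apply/measurable_EFinP; apply: measurable_funM; last exact: mg.
    exact: measurable_enorm_lt.
  have k1 x h : (0 <= ((enorm h < t)%R%:R * g x h)%:E)%E.
    by rewrite lee_fin mulr_ge0.
  case: ifPn => [_|].
    rewrite /shift_energy -ge0_integralZl_EFin//; last 3 first.
      by move=> x _; exact: integral_ge0.
      by apply: (measurable_fun_fubini_tonelli_F _ m1) => z; exact: k1.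
      exact: powR_ge0.
    apply: eq_integral => x _; rewrite /G -ge0_integralZl_EFin//; last 2 first.
      exact: (measurableT_comp m1 (measurable_pair1 _)).
      exact: powR_ge0.
    by apply: eq_integral => h _; rewrite -EFinM /k mulrCA -mulrA mulrCA mulrA.
  (* For [t <= 0] no [h] satisfies [enorm h < t], so [t] may range over the whole line. *)
  rewrite notin_setE /= in_itv/= andbT => /negP; rewrite -leNgt => t0.
  rewrite integral0_eq// => x _; rewrite /G integral0_eq// => h _.
  by rewrite /k ltNge (le_trans t0) ?enorm_ge0// !mul0r.
rewrite [LHS](@fubini_tonelli _ _ _ _ R lebesgue_measure (leb N)
  (fun z => G z.1 z.2) mG (fun z => G0 _ _)).
transitivity (\int[leb N]_x \int[leb N]_h \int[lebesgue_measure]_t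
   (k t h * g x h)%:E)%E.
  apply: eq_integral => x _; rewrite /G.
  apply: (@fubini_tonelli _ _ _ _ R lebesgue_measure (leb N)
      (fun z => (k z.1 z.2 * g x z.2)%:E)); last first.
    by move=> z; rewrite lee_fin mulr_ge0.
  by apply/measurable_EFinP; apply: measurable_funM; [exact: mk|exact: mg].
pose f (z : 'rV[R]_N * 'rV[R]_N) := (`|u z.1 - u z.2| `^ p / enorm (z.1 - z.2) `^ q).
have f0 z : (0 <= (f z)%:E)%E by rewrite lee_fin divr_ge0 ?powR_ge0.
have mf : measurable_fun setT (fun z => (f z)%:E).
  apply/measurable_EFinP; apply: measurable_funM.
    apply: (measurableT_comp (measurable_powR _)).
    apply: measurableT_comp => //.
    by apply: measurable_funB; exact: measurableT_comp.
  rewrite (_ : (fun z => _) = (fun z : 'rV[R]_N * 'rV[R]_N =>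
    enorm (z.1 - z.2) `^ (- q))); last first.
    by apply/funext => z; rewrite powRN.
  apply: (measurableT_comp (measurable_powR _)).
  by apply: (measurableT_comp measurable_enorm); exact: measurable_rV_sub.
transitivity (\int[leb N]_x \int[leb N]_y ((q^-1)%:E * (f (x, y))%:E))%E.
  apply: eq_integral => x _.
  rewrite -[RHS](ge0_integral_leb_shift x)//; last 2 first.
    by apply: measurable_funeM; exact: (measurableT_comp mf (measurable_pair1 _)).
    by move=> y; rewrite mule_ge0// lee_fin invr_ge0 ltW.
  apply: eq_integral => h _.
  rewrite /f /= opprD addrCA subrr addr0 enormN distrC (addrC h) -/(g x h).
  (* At [h = 0] both sides vanish, since the increment is [0] and [p > 0]; this is the diagonal of
     [D_norm]. *)
  have [->|h0] := eqVneq h 0.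
    rewrite /g addr0 subrr normr0 powR0 ?gt_eqF// mul0r mule0 integral0_eq//.
    by move=> t _; rewrite mulr0.
  have eh0 : 0 < enorm h.
    rewrite lt_neqAle enorm_ge0 andbT eq_sym.
    by apply: contra_neq h0; exact: enorm_eq0.
  under eq_integral do rewrite mulrC EFinM.
  rewrite ge0_integralZl_EFin//; last 2 first.
    by move=> t _; rewrite lee_fin.
    apply/measurable_EFinP.
    exact: mk.
  rewrite (_ : \int[_]_t _ =
    \int[lebesgue_measure]_(t in `]enorm h, +oo[) (t `^ (- q - 1))%:E)%E.
    by rewrite integral_powR_tail// -!EFinM powRN; congr EFin; lra.
  rewrite [RHS]integral_mkcond; apply: eq_integral => t _; rewrite patchE.
  case: ifPn; rewrite /k ?inE ?notin_setE/= in_itv/= andbT.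
    by move=> ->; rewrite mul1r.
  by move=> /negP/negbTE ->; rewrite mul0r.
rewrite /D_norm -poweRrM mulVf ?gt_eqF// poweRe1; last first.
  by apply: integral_ge0 => z _; exact: f0.
rewrite (fubini_tonelli1 (fun z => (f z)%:E))//.
rewrite -ge0_integralZl_EFin//; last 3 first.
  by move=> x _; exact: integral_ge0.
  exact: measurable_fun_fubini_tonelli_F.
  by rewrite invr_ge0 ltW.
apply: eq_integral => x _; rewrite /fubini_F ge0_integralZl_EFin//.
  exact: (measurableT_comp mf (measurable_pair1 _)).
by rewrite invr_ge0 ltW.
Qed.

End shift_energy.

(** * Test functions and their correlations with a kernel *)

Section calculus_rV.
Context {R : realType} {N : nat}.
Implicit Types (u : 'rV[R]_N -> R) (x y h : 'rV[R]_N) (i : 'I_N).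

Local Notation e i := (delta_mx ord0 i : 'rV[R]_N).

(** Reduces directional derivatives to one real variable, where the mean value theorem and the
    fundamental theorem of calculus apply. *)
Lemma is_derive_line u x (v : 'rV[R]_N) (t : R) :
  derivable (u : 'rV[R]_N -> R^o) (x + t *: v) v ->
  is_derive t 1 (fun t => u (x + t *: v) : R^o)
    ('D_v (u : 'rV[R]_N -> R^o) (x + t *: v)).
Proof.
have E : (fun h : R => h^-1 *: (((fun t => u (x + t *: v) : R^o) \o shift t) (h *: 1) -
           u (x + t *: v) : R^o)) =
       (fun h : R => h^-1 *: (((u : 'rV[R]_N -> R^o) \o shift (x + t *: v)) (h *: v) -
           u (x + t *: v))).
  apply/funext => h /=; congr (_ *: (u _ - _)).
  by rewrite [h *: 1]mulr1 scalerDl addrCA.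
by move=> d; apply: DeriveDef; rewrite /derivable /derive E.
Qed.

Lemma line_lipschitz u x i (M t : R) :
  (forall x, derivable (u : 'rV[R]_N -> R^o) x (e i)) ->
  (forall x, `|partial i u x| <= M) ->
  `|u (x + t *: e i) - u x| <= M * `|t|.
Proof.
move=> du uM.
wlog t0 : x t / 0 < t.
  move=> H; have [t0|t0|<-] := ltgtP 0 t.
  - exact: H.
  - have := H (x + t *: e i) (- t); rewrite -addrA -scalerDl subrr scale0r addr0.
    by rewrite distrC normrN oppr_gt0; exact.
  - by rewrite scale0r addr0 subrr !normr0 mulr0.
have [||c _] := @MVT R (fun t => u (x + t *: e i))
    (fun t => partial i u (x + t *: e i)) 0 t t0.
- by move=> r _; exact: is_derive_line.
- apply: derivable_within_continuous => r _.
  by have [] := is_derive_line (du (x + r *: e i)).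
rewrite scale0r addr0 subr0 => ->.
by rewrite normrM ler_wpM2r.
Qed.

(** Vertices of the staircase path from [0] to [h] along the coordinate axes. [smooth] speaks of
    partial derivatives only, so increments are split along this path instead of being taken along
    the segment. *)
Definition row_prefix (k : nat) h : 'rV[R]_N :=
  \row_j (if (j < k)%N then h ord0 j else 0).

Lemma row_prefix0 h : row_prefix 0 h = 0.
Proof. by apply/rowP => j; rewrite !mxE. Qed.

Lemma row_prefixN h : row_prefix N h = h.
Proof. by apply/rowP => j; rewrite !mxE ltn_ord. Qed.

Lemma row_prefixS i h : row_prefix i.+1 h = row_prefix i h + h ord0 i *: e i.
Proof.
apply/rowP => j; rewrite !mxE eqxx /= ltnS leq_eqVlt -val_eqE/=.
by case: ltngtP => ij; rewrite ?mulr0 ?addr0 ?mulr1 ?add0r//; congr (h _ _); exact/val_inj.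
Qed.

Lemma telescope_row u x h : u (x + h) - u x =
  \sum_(i < N) (u (x + row_prefix i h + h ord0 i *: e i) - u (x + row_prefix i h)).
Proof.
rewrite -[in LHS](row_prefixN h) -[in X in _ - X](addr0 x) -(row_prefix0 h).
rewrite -(telescope_sumr (fun k => u (x + row_prefix k h)))// big_mkord.
by apply: eq_bigr => i _; rewrite row_prefixS addrA.
Qed.

Lemma partial_bounded_lipschitz u (M : R) :
  (forall x i, derivable (u : 'rV[R]_N -> R^o) x (e i)) ->
  (forall i x, `|partial i u x| <= M) ->
  forall x h, `|u (x + h) - u x| <= N%:R * M * `|h|.
Proof.
move=> du uM x h; rewrite telescope_row.
apply: le_trans (ler_norm_sum _ _ _) _.
apply: (@le_trans _ _ (\sum_(i < N) M * `|h|)); last first.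
  by rewrite sumr_const card_ord -[leLHS]mulr_natl mulrA.
apply: ler_sum => i _; apply: le_trans (line_lipschitz _ _ _ _) _ => //.
by rewrite ler_wpM2l ?rV_coord_le// (le_trans _ (uM i 0)).
Qed.

(** [C0infty] without the domain: the analysis takes place on the whole space, and [Omega] only
    matters for supports. *)
Definition test_fun u := smooth u /\ compact (supp u).

Lemma partial_out_supp i u x : ~ supp u x -> partial i u x = 0.
Proof.
move=> nx; rewrite /partial.
rewrite (@near_eq_derive _ _ _ _ (cst 0)) ?derive_cst//.
have oS : open (~` supp u) by apply: closed_openC; exact: closed_closure.
apply: filterS (open_nbhs_nbhs (conj oS nx)) => y /= ny.
by apply: contra_notP ny => /eqP uy; exact: subset_closure.
Qed.

Lemma supp_partial i u : supp (partial i u) `<=` supp u.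
Proof.
rewrite [X in _ `<=` X](closure_id _).1; last exact: closed_closure.
apply: closure_subset => x /=.
by apply: contra_neqP; exact: partial_out_supp.
Qed.

Lemma test_fun_partial i u : test_fun u -> test_fun (partial i u).
Proof.
move=> [su cu]; split; first by move=> l; have := su (rcons l i); rewrite foldr_rcons.
apply: subclosed_compact cu _; first exact: closed_closure.
exact: supp_partial.
Qed.

Lemma test_fun_continuous u : test_fun u -> continuous u.
Proof. by move=> [su _]; have [] := su [::]. Qed.

Lemma test_fun_derivable u x i : test_fun u ->
  derivable (u : 'rV[R]_N -> R^o) x (e i).
Proof. by move=> [su _]; have [_] := su [::]; exact. Qed.

Lemma test_fun_bounded u : test_fun u -> exists2 M : R, 0 <= M & forall x, `|u x| <= M.
Proof.
move=> tu; have cu := test_fun_continuous tu.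
have /compact_bounded[M [Mr /(_ (`|M| + 1))]] : compact (u @` supp u).
  apply: continuous_compact; last by case: tu.
  exact: continuous_subspaceT.
rewrite (le_lt_trans (ler_norm M)) ?ltrDl// => /(_ isT) uM.
exists (`|M| + 1); first by rewrite addr_ge0.
move=> x; have [ux|ux] := eqVneq (u x) 0; first by rewrite ux normr0 addr_ge0.
by apply: uM; exists x => //; exact: subset_closure.
Qed.

Lemma test_fun_partial_bounded u : test_fun u ->
  exists2 M : R, 0 <= M & forall i x, `|partial i u x| <= M.
Proof.
move=> tu; have /(_ _)/cid2-/all_sig2[M M0 uM] : forall i,
    exists2 M : R, 0 <= M & forall x, `|partial i u x| <= M.
  by move=> i; exact/test_fun_bounded/test_fun_partial.
exists (\sum_i M i); first by exact: sumr_ge0.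
move=> i x; apply: le_trans (uM i x) _.
by rewrite (bigD1 i)//= lerDl sumr_ge0.
Qed.

End calculus_rV.

(** * Smoothness of correlations *)

Section correlation.
Context {R : realType} {N : nat}.
Implicit Types (u phi : 'rV[R]_N -> R) (x y h : 'rV[R]_N) (i : 'I_N).

Local Notation e i := (delta_mx ord0 i : 'rV[R]_N).

Definition correlation phi u x : R := \int[leb N]_h (u (x + h) * phi h).

Definition integrable_kernel phi :=
  (leb N).-integrable setT (fun h => (phi h)%:E).

Lemma measurable_test_fun u : test_fun u -> measurable_fun setT u.
Proof.
by move=> tu; apply: continuous_measurable_rV; exact: test_fun_continuous.
Qed.

Lemma integrable_correlation phi u x : integrable_kernel phi -> test_fun u ->
  (leb N).-integrable setT (EFin \o (fun h => u (x + h) * phi h)).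
Proof.
move=> iphi tu; have [M M0 uM] := test_fun_bounded tu.
have mu : measurable_fun setT (fun h => u (x + h)).
  apply: (measurableT_comp (measurable_test_fun tu)).
  exact: measurable_rV_add.
apply: (@le_integrable _ _ _ (leb N) setT _ _ (fun h => M%:E * `|(phi h)%:E|)%E) => //.
- apply/measurable_EFinP; apply: measurable_funM => //.
  by apply/measurable_EFinP; case/integrableP: iphi.
- move=> h _ /=; rewrite lee_fin normrM.
  by rewrite [leRHS]ger0_norm ?mulr_ge0// ler_wpM2r.
- exact/integrableZl/integrable_abse.
Qed.

Lemma correlation_lipschitz phi u x y (L : R) : integrable_kernel phi -> test_fun u ->
  (forall x h, `|u (x + h) - u x| <= L * `|h|) ->
  `|correlation phi u y - correlation phi u x| <=
    L * `|y - x| * \int[leb N]_h `|phi h|.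
Proof.
move=> iphi tu uL; rewrite /correlation -RintegralB//; last 2 first.
  exact: integrable_correlation. exact: integrable_correlation.
have iB : (leb N).-integrable setT
    (EFin \o (fun h => u (y + h) * phi h - u (x + h) * phi h)).
  exact: (integrableB measurableT (integrable_correlation y iphi tu)
    (integrable_correlation x iphi tu)).
apply: le_trans (le_normr_Rintegral _ _) _ => //.
rewrite -RintegralZl//; last exact: integrable_norm.
apply: le_Rintegral => //.
- exact: integrable_norm.
- exact: (integrableZl measurableT _ (integrable_norm _)).
- move=> h _; rewrite -mulrBl normrM ler_wpM2r//.
  by have := uL (x + h) (y - x); rewrite addrAC (addrC x) subrK.
Qed.

Lemma correlation_continuous phi u : integrable_kernel phi -> test_fun u ->
  continuous (correlation phi u).
Proof.
move=> iphi tu x; have [M M0 uM] := test_fun_partial_bounded tu.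
have uL := partial_bounded_lipschitz (fun x i => @test_fun_derivable _ _ u x i tu) uM.
set L := N%:R * M in uL; set I := \int[leb N]_h `|phi h|.
have I0 : 0 <= I by exact: Rintegral_ge0.
have L0 : 0 <= L by rewrite mulr_ge0.
apply/(@cvgrPdist_le _ R^o _ (nbhs (x : 'rV[R]_N)) (nbhs_filter _)) => ep ep0.
have d0 : 0 < ep / (L * I + 1) by rewrite divr_gt0// ltr_wpDl// mulr_ge0.
apply/nbhs_ballP; exists (ep / (L * I + 1)) => //= y.
rewrite mx_norm_ball /= => xy.
rewrite distrC (le_trans (correlation_lipschitz _ _ iphi tu uL))//.
rewrite mulrAC; apply: (@le_trans _ _ ((L * I + 1) * `|y - x|)).
  by rewrite ler_wpM2r// lerDl.
by rewrite mulrC -ler_pdivlMr ?ltr_wpDl ?mulr_ge0// distrC ltW.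
Qed.

(** Differentiation under the integral sign, the difference quotients being controlled by
    [M * |phi h|] with [M] a bound on the partial derivatives of [u]. The derivative falls on [u],
    so integrability of the kernel suffices and the argument can be iterated. *)
Lemma derivable_correlation phi u x i : integrable_kernel phi -> test_fun u ->
  derivable (correlation phi u : 'rV[R]_N -> R^o) x (e i) /\
  partial i (correlation phi u) x = correlation phi (partial i u) x.
Proof.
move=> iphi tu; have [M M0 uM] := test_fun_partial_bounded tu.
pose f (t : R) h := u (x + h + t *: e i) * phi h.
have df (t : R) h : is_derive t 1 (f ^~ h : R -> R^o) (partial i u (x + h + t *: e i) * phi h).
  have d := is_derive_line (@test_fun_derivable _ _ u (x + h + t *: e i) i tu).
  apply: DeriveDef; first by apply: derivableM => //; case: d.
  rewrite deriveMr; last by case: d.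
  by have [_ ->] := d; exact: mulrC.
have intf t : `](-1), 1[%classic t -> (leb N).-integrable setT (EFin \o f t).
  move=> _; have := @integrable_correlation phi u (x + t *: e i) iphi tu.
  by apply: eq_integrable => // h _; rewrite /f /= addrAC.
have I0 : `](-1), 1[%classic (0 : R) by rewrite /= in_itv/= oppr_lt0 ltr01.
have Gint : (leb N).-integrable setT (EFin \o (fun h => M * `|phi h|)).
  exact: (integrableZl measurableT _ (integrable_norm _)).
have Gge0 h : 0 <= M * `|phi h| by rewrite mulr_ge0.
have fG (t : R) h : `](-1), 1[%classic t -> setT h -> `|partial1of2 f t h| <= M * `|phi h|.
  move=> _ _; rewrite partial1of2E; have [_ ->] := df t h.
  by rewrite normrM ler_wpM2r.
have dfe (t : R) h : `](-1), 1[%classic t -> setT h -> derivable (f ^~ h) t 1.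
  by move=> _ _; have [] := df t h.
have C := cvg_differentiation_under_integral measurableT I0 intf dfe Gge0 Gint fG.
have E : (fun t : R => t^-1 *: (\int[leb N]_y f (t + 0) y - \int[leb N]_y f 0 y)) =
  (fun t : R => t^-1 *: (((correlation phi u : 'rV[R]_N -> R^o) \o shift x) (t *: e i) -
           correlation phi u x)).
  apply/funext => t; congr (_ *: (_ - _)); apply: eq_Rintegral => h _; rewrite /f /=.
    by rewrite addr0 [_ + x]addrC addrAC.
  by rewrite scale0r addr0.
have F : \int[leb N]_y partial1of2 f 0 y = correlation phi (partial i u) x.
  apply: eq_Rintegral => h _; rewrite partial1of2E; have [_ ->] := df 0 h.
  by rewrite scale0r addr0.
rewrite F E in C; split; first by apply/cvg_ex; eexists; exact: C.
exact/cvg_lim.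
Qed.

Lemma test_fun_correlation_smooth phi u : integrable_kernel phi -> test_fun u ->
  smooth (correlation phi u).
Proof.
move=> iphi tu l /=.
suff -> : foldr partial (correlation phi u) l = correlation phi (foldr partial u l).
  have tl : test_fun (foldr partial u l).
    by elim: l => //= i l; exact: test_fun_partial.
  split; first exact: correlation_continuous.
  by move=> i x; have [] := derivable_correlation x i iphi tl.
elim: l => //= i l ->.
have tl : test_fun (foldr partial u l).
  by elim: l => //= j l; exact: test_fun_partial.
by apply/funext => x; have [_ ->] := derivable_correlation x i iphi tl.
Qed.

End correlation.

(** * Pointwise bounds by the local oscillation *)

Section oscillation.
Context {R : realType} {N : nat}.
Implicit Types (u phi : 'rV[R]_N -> R) (x y h c : 'rV[R]_N) (i : 'I_N).

Local Notation e i := (delta_mx ord0 i : 'rV[R]_N).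

Lemma norm_delta_rV i : `|e i| = 1.
Proof.
apply/eqP; rewrite eq_le; apply/andP; split; last first.
  by apply: le_trans (rV_coord_le _ i); rewrite mxE !eqxx normr1.
apply/rV_norm_leP => // j; rewrite mxE eqxx /=.
by case: eqP; rewrite ?normr1 ?normr0.
Qed.

(** An unnormalised local mean. It dominates both the approximation error and the gradient of a
    correlation, which reduces the two terms of the K-functional to the same estimate. *)
Definition oscillation (B : set 'rV[R]_N) u x : R :=
  \int[leb N]_(h in B) `|u (x + h) - u x|.

Lemma integrable_shift_sub (B : set 'rV[R]_N) u x :
  measurable B -> (leb N B < +oo)%E -> test_fun u ->
  (leb N).-integrable B (EFin \o (fun h => u (x + h) - u x)).
Proof.
move=> mB Boo tu; have [M M0 uM] := test_fun_bounded tu.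
apply: measurable_bounded_integrable => //.
  apply: measurable_funB => //; apply: measurable_funTS.
  apply: (measurableT_comp (measurable_test_fun tu)).
  exact: measurable_rV_add.
exists (M + M); split; first exact: num_real.
move=> K MK y _; apply: le_trans (ltW MK).
by rewrite (le_trans (ler_normB _ _))// lerD.
Qed.

Lemma le_oscillation (B : set 'rV[R]_N) u psi x (A : R) :
  measurable B -> (leb N B < +oo)%E -> test_fun u ->
  integrable_kernel psi -> (forall h, `|psi h| <= A) ->
  (forall h, ~ B h -> psi h = 0) ->
  `|\int[leb N]_h ((u (x + h) - u x) * psi h)| <= A * oscillation B u x.
Proof.
move=> mB Boo tu ipsi psiA psi0.
have iB := @integrable_shift_sub B u x mB Boo tu.
have A0 : 0 <= A by exact: le_trans (psiA 0).
have intB : (leb N).-integrable B (EFin \o (fun h => (u (x + h) - u x) * psi h)).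
  apply: (@le_integrable _ _ _ (leb N) B _ _ (fun h => A%:E * (`|u (x + h) - u x|)%:E)%E) => //.
  - apply/measurable_EFinP; apply: measurable_funM.
      by apply/measurable_EFinP; case/integrableP: iB.
    by apply: measurable_funTS; apply/measurable_EFinP; case/integrableP: ipsi.
  - move=> h _ /=; rewrite lee_fin normrM.
    by rewrite [leRHS]ger0_norm ?mulr_ge0// mulrC ler_wpM2r.
  - exact: (integrableZl mB _ (integrable_norm iB)).
rewrite (_ : \int[leb N]_h _ = \int[leb N]_(h in B) ((u (x + h) - u x) * psi h)); last first.
  rewrite [RHS]Rintegral_mkcond; apply: eq_Rintegral => h _.
  rewrite patchE; case: ifPn => //; rewrite notin_setE => /psi0 ->.
  by rewrite mulr0.
apply: le_trans (le_normr_Rintegral _ _) _ => //.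
rewrite -RintegralZl//; last exact: integrable_norm.
apply: le_Rintegral => //.
- exact: integrable_norm.
- exact: (integrableZl mB _ (integrable_norm iB)).
- by move=> h _; rewrite normrM mulrC ler_wpM2r.
Qed.

Section kernel.
Variables (u phi : 'rV[R]_N -> R) (c : 'rV[R]_N) (rho A L : R).
Hypotheses (tu : test_fun u) (iphi : integrable_kernel phi).
Hypotheses (rho0 : 0 < rho) (phiA : forall h, `|phi h| <= A).
Hypotheses (phiL : forall h z, `|phi (h + z) - phi h| <= L * `|z|).
Hypotheses (phi0 : forall h, rho <= `|h - c| -> phi h = 0).
Hypotheses (phi1 : \int[leb N]_h phi h = 1).

(** Twice the radius of the support of [phi], so as to contain the support of every translate of
    [phi] by a vector of length at most [rho]. *)
Let B : set 'rV[R]_N := ball c (2 * rho).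

Let mB : measurable B. Proof. exact: measurable_rV_ball. Qed.

Let Boo : (leb N B < +oo)%E.
Proof. by rewrite /B leb_ball ?ltry// mulr_gt0. Qed.

Let integrable_cst_kernel (a : R) psi : integrable_kernel psi ->
  (leb N).-integrable setT (EFin \o (fun h => a * psi h)).
Proof. by move=> ipsi; exact: (integrableZl measurableT _ ipsi). Qed.

Lemma correlation_sub_kernel x :
  correlation phi u x - u x = \int[leb N]_h ((u (x + h) - u x) * phi h).
Proof.
under [RHS]eq_Rintegral do rewrite mulrBl.
rewrite RintegralB//; last 2 first.
  exact: integrable_correlation.
  exact: integrable_cst_kernel.
by rewrite RintegralZl// phi1 mulr1.
Qed.

Lemma correlation_approx x :
  `|correlation phi u x - u x| <= A * oscillation B u x.
Proof.
rewrite correlation_sub_kernel; apply: le_oscillation => // h.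
rewrite /B mx_norm_ball /= => /negP; rewrite -leNgt distrC => hc.
by apply: phi0; apply: le_trans hc; rewrite ler_peMl ?ltW// ltr1n.
Qed.

(* Translating the increment onto [phi], whose differences have integral zero,
   produces [u (x + h) - u x] without integrating by parts. *)
Lemma correlation_increment x i (t : R) : `|t| <= rho ->
  `|correlation phi u (x + t *: e i) - correlation phi u x| <=
    L * `|t| * oscillation B u x.
Proof.
move=> trho; pose phit h := phi (h - t *: e i).
have iphit : integrable_kernel phit by exact: (integrable_leb_shift (- (t *: e i)) iphi).
have -> : correlation phi u (x + t *: e i) = correlation phit u x.
  rewrite /correlation /Rintegral; congr fine.
  have := @integral_leb_shift R N (t *: e i) (fun h => (u (x + h) * phit h)%:E).
  rewrite /phit => <-; last exact: integrable_correlation.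
  by apply: eq_integral => h _; rewrite addrK (addrC h) addrA.
have int0 : \int[leb N]_h (phit h - phi h) = 0.
  rewrite RintegralB// /Rintegral /phit.
  by rewrite (integral_leb_shift _ iphi) subrr.
have ipsi : integrable_kernel (fun h => phit h - phi h).
  exact: (integrableB measurableT iphit iphi).
rewrite (_ : _ - _ = \int[leb N]_h ((u (x + h) - u x) * (phit h - phi h))).
  apply: le_oscillation => // [h|h].
    by apply: le_trans (phiL _ _) _; rewrite normrN normrZ norm_delta_rV mulr1.
  rewrite /B mx_norm_ball /= => /negP; rewrite -leNgt distrC => hc.
  rewrite [phi h]phi0; last by apply: le_trans hc; rewrite ler_peMl ?ltW// ltr1n.
  rewrite /phit phi0 ?subrr// addrAC.
  apply: le_trans (lerB_normD _ _); rewrite normrN normrZ norm_delta_rV mulr1.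
  by rewrite lerBrDr (le_trans _ hc)// mulrDl mul1r lerD2l.
transitivity (\int[leb N]_h ((u (x + h) * phit h - u (x + h) * phi h) -
    u x * (phit h - phi h))); last first.
  by apply: eq_Rintegral => h _; rewrite mulrBl -mulrBr.
have i1 := @integrable_correlation _ _ phit u x iphit tu.
have i2 := @integrable_correlation _ _ phi u x iphi tu.
rewrite RintegralB//; last 2 first.
  exact: (integrableB measurableT i1 i2).
  exact: integrable_cst_kernel.
by rewrite RintegralZl// int0 mulr0 subr0 RintegralB.
Qed.

(** The increment bound is linear in [|t|] for [|t| <= rho], so it survives in the limit of the
    difference quotients. *)
Lemma correlation_partial_le x i :
  `|partial i (correlation phi u) x| <= L * oscillation B u x.
Proof.
have [d _] := @derivable_correlation _ _ phi u x i iphi tu.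
rewrite /partial /derive.
have {}d := cvg_norm (FF := dnbhs_filter 0) d.
apply: (cvgr_to_le d) => /=.
near=> t.
have t0 : t != 0 by near: t; exact: nbhs_dnbhs_neq.
rewrite normrZ normfV mulrC ler_pdivrMr ?normr_gt0// mulrAC.
rewrite [_ *: _ + x]addrC; apply: correlation_increment.
by near: t; exact: dnbhs0_le.
Unshelve. all: by end_near. Qed.

End kernel.
End oscillation.

Lemma integrable_indic_lty d (T : measurableType d) (R : realType)
    (mu : {measure set T -> \bar R}) (A : set T) :
  measurable A -> (mu A < +oo)%E ->
  mu.-integrable setT (EFin \o (\1_A : T -> R)).
Proof.
move=> mA Aoo; apply/integrableP; split.
  by apply/measurable_EFinP; exact: measurable_indic.
rewrite (eq_integral (fun x => (\1_A x)%:E)) => [|x _].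
  by rewrite integral_indic// setIT.
by rewrite gee0_abs// lee_fin.
Qed.

(** * A Lipschitz bump on a cube *)

Section tent.
Context {R : realType} {N : nat}.
Implicit Types (c x h z : 'rV[R]_N) (rho : R).

(** A pyramid of slope [1]: its height, its Lipschitz constant and a lower bound on its mass are
    explicit, which keeps the final constant explicit. *)
Definition tent c rho h : R := Num.max 0 (rho - `|h - c|).

Lemma tent_ge0 c rho h : 0 <= tent c rho h.
Proof. by rewrite /tent le_max lexx. Qed.

Lemma tent_le c rho h : 0 <= rho -> tent c rho h <= rho.
Proof. by move=> r0; rewrite /tent ge_max r0 gerBl normr_ge0. Qed.

Lemma tent_eq0 c rho h : rho <= `|h - c| -> tent c rho h = 0.
Proof. by move=> rh; apply/max_idPl; rewrite subr_le0. Qed.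

Lemma tent_lipschitz c rho h z :
  `|tent c rho (h + z) - tent c rho h| <= `|z|.
Proof.
have H (a b : R) : `|Num.max 0 a - Num.max 0 b| <= `|a - b|.
  by rewrite ler_norml; case: (lerP a b); case: (lerP 0 a); case: (lerP 0 b) => *; lra.
apply: le_trans (H _ _) _.
rewrite (_ : _ - _ - _ = `|h - c| - `|h + z - c|); last by ring.
apply: le_trans (ler_dist_dist _ _) _.
by rewrite opprB addrA subrK opprD addrA subrr sub0r normrN.
Qed.

Lemma measurable_tent c rho : measurable_fun setT (tent c rho).
Proof.
apply: measurable_maxr => //; apply: measurable_funB => //.
have mn : measurable_fun setT (fun h : 'rV[R]_N => `|h|).
  by apply: continuous_measurable_rV; exact: norm_continuous.
exact: (measurableT_comp mn (measurable_rV_addr (- c))).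
Qed.

Lemma integrable_tent c rho : 0 < rho -> integrable_kernel (tent c rho).
Proof.
move=> r0; pose B : set 'rV[R]_N := ball c rho.
have mB : measurable B by exact: measurable_rV_ball.
have Boo : (leb N B < +oo)%E by rewrite /B leb_ball ?ltry.
apply: (@le_integrable _ _ _ (leb N) setT _ _ (fun h => rho%:E * (\1_B h)%:E)%E) => //.
- by apply/measurable_EFinP; exact: measurable_tent.
- move=> h _ /=; rewrite lee_fin ger0_norm ?tent_ge0//.
  rewrite ger0_norm; last by rewrite mulr_ge0// ltW.
  rewrite indicE; case: (boolP (h \in B)) => hB.
    by rewrite mulr1 tent_le// ltW.
  rewrite mulr0 tent_eq0//; move: hB; rewrite notin_setE /B mx_norm_ball /=.
  by move/negP; rewrite -leNgt distrC.
- apply: integrableZl => //; exact: integrable_indic_lty.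
Qed.

(** On the concentric cube of radius [rho / 2], of volume [rho ^ N], the tent is at least
    [rho / 2]. *)
Lemma tent_mass c rho : 0 < rho ->
  rho ^+ N.+1 / 2 <= \int[leb N]_h tent c rho h.
Proof.
move=> r0; have r20 : 0 < rho / 2 by rewrite divr_gt0.
pose B : set 'rV[R]_N := ball c (rho / 2).
have mB : measurable B by exact: measurable_rV_ball.
have Boo : (leb N B < +oo)%E by rewrite /B leb_ball ?ltry.
apply: (@le_trans _ _ (\int[leb N]_h (rho / 2 * \1_B h))).
  rewrite RintegralZl//; last exact: integrable_indic_lty.
  rewrite /Rintegral integral_indic//= setIT /B leb_ball//=.
  by rewrite mulrCA mulfV// mulr1 exprS mulrAC.
apply: le_Rintegral => //.
- exact: (integrableZl measurableT _ (integrable_indic_lty mB Boo)).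
- exact: integrable_tent.
- move=> h _; rewrite indicE; case: (boolP (h \in B)) => hB.
    move: hB; rewrite inE /B mx_norm_ball /= distrC => hB.
    rewrite mulr1 /tent le_max; apply/orP; right; lra.
  by rewrite mulr0 tent_ge0.
Qed.

Definition unit_tent c rho h := (\int[leb N]_h tent c rho h)^-1 * tent c rho h.

Section unit_tent.
Variables (c : 'rV[R]_N) (rho : R).
Hypothesis rho0 : 0 < rho.

Let mass_gt0 : 0 < \int[leb N]_h tent c rho h.
Proof. by apply: lt_le_trans (tent_mass c rho0); rewrite divr_gt0// exprn_gt0. Qed.

Let invmass : (\int[leb N]_h tent c rho h)^-1 <= 2 / rho ^+ N.+1.
Proof.
rewrite -[2]invrK -invfM lef_pV2 ?posrE//; last first.
  by rewrite mulr_gt0// ?invr_gt0// exprn_gt0.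
by rewrite mulrC; exact: tent_mass.
Qed.

Lemma integrable_unit_tent : integrable_kernel (unit_tent c rho).
Proof. exact: (integrableZl measurableT _ (integrable_tent c rho0)). Qed.

(** The height [rho] divided by the mass. For the Lipschitz constant the slope [1] replaces the
    height, whence one more power of [rho] in the denominator. *)
Lemma unit_tent_le h : `|unit_tent c rho h| <= 2 / rho ^+ N.
Proof.
rewrite /unit_tent ger0_norm; last first.
  by rewrite mulr_ge0 ?tent_ge0// invr_ge0 ltW.
apply: (@le_trans _ _ (2 / rho ^+ N.+1 * rho)); last first.
  by rewrite exprS invfM mulrA mulrAC divfK// gt_eqF.
apply: ler_pM => //; [by rewrite invr_ge0 ltW|exact: tent_ge0|].
exact/tent_le/ltW.
Qed.

Lemma unit_tent_lipschitz h z :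
  `|unit_tent c rho (h + z) - unit_tent c rho h| <= 2 / rho ^+ N.+1 * `|z|.
Proof.
rewrite /unit_tent -mulrBr normrM; apply: ler_pM => //; last first.
  exact: tent_lipschitz.
by rewrite ger0_norm// invr_ge0 ltW.
Qed.

Lemma unit_tent_eq0 h : rho <= `|h - c| -> unit_tent c rho h = 0.
Proof. by move=> rh; rewrite /unit_tent tent_eq0// mulr0. Qed.

Lemma integral_unit_tent : \int[leb N]_h unit_tent c rho h = 1.
Proof.
rewrite RintegralZl//; last exact: integrable_tent.
by rewrite mulVf// gt_eqF.
Qed.

End unit_tent.
End tent.

(** * Support of a correlation *)

Section correlation_support.
Context {R : realType} {N : nat}.
Implicit Types (u phi : 'rV[R]_N -> R) (c x h : 'rV[R]_N).

(** If [u (x + h) * phi h] is nonzero, then [x = (x + h) - h] lies in the difference set of [supp u]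
    and the closed cube [Q]. That set is a continuous image of a compact set, hence compact and
    closed, and the last hypothesis puts it inside [Omega]. *)
Lemma correlation_supp phi u c (rho : R) (Omega : set 'rV[R]_N) :
  integrable_kernel phi -> C0infty Omega u -> 
  (forall h, rho < `|h - c| -> phi h = 0) ->
  (forall y h, Omega y -> `|h - c| <= rho -> Omega (y - h)) ->
  C0infty Omega (correlation phi u).
Proof.
move=> iphi [su [cu uO]] phi0 Osub; have tu : test_fun u by [].
pose Q : set 'rV[R]_N := [set h | `|h - c| <= rho].
have cQ : compact Q.
  have [rho0|rho0] := leP 0 rho; last first.
    rewrite (_ : Q = set0); first exact: compact0.
    by apply/seteqP; split => // h; rewrite /Q /= leNgt (lt_le_trans rho0).
  (* A closed ball of the maximum norm is a product of segments. *)
  have : compact [set h : 'rV[R]_N | forall i,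
      `[c ord0 i - rho, c ord0 i + rho]%classic (h ord0 i)].
    apply: (@rV_compact _ _ (fun i => `[c ord0 i - rho, c ord0 i + rho]%classic)).
    by move=> i; exact: segment_compact.
  congr compact; apply/seteqP; split => h /=.
    move=> hi; apply/rV_norm_leP => // i; rewrite !mxE ler_distl.
    by have := hi i; rewrite in_itv.
  move=> /(rV_norm_leP _ rho0) hi i; have := hi i.
  by rewrite !mxE ler_distl in_itv.
pose S := (fun z : 'rV[R]_N * 'rV[R]_N => z.1 - z.2) @` (supp u `*` Q).
have cS : compact S.
  apply: continuous_compact; last exact: compact_setX.
  by apply: continuous_subspaceT; exact: sub_continuous.
have vS : supp (correlation phi u) `<=` S.
  rewrite (closure_id S).1; last by apply: compact_closed => //; exact: norm_hausdorff.
  apply: closure_subset => x /=; apply: contra_neqP => nS.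
  rewrite /correlation (_ : (fun h => _) = cst 0) ?Rintegral_cst ?mul0r//.
  apply/funext => h /=.
  have [hc|hc] := leP `|h - c| rho; last by rewrite phi0// mulr0.
  have [->|ux] := eqVneq (u (x + h)) 0; first by rewrite mul0r.
  exfalso; apply: nS; exists (x + h, h) => /=; last by rewrite addrK.
  by split => //; exact: subset_closure.
split; first exact: test_fun_correlation_smooth.
split; first by apply: subclosed_compact cS vS; exact: closed_closure.
by apply: (subset_trans vS) => _ [[y h] [/= /uO Oy hQ] <-]; exact: Osub.
Qed.

End correlation_support.

(** * Upper bound of the K-functional *)

Lemma conjugate_exponentE {R : realFieldType} (p : R) : 1 < p ->
  [/\ 0 < p, 0 < p / (p - 1), p^-1 + (p / (p - 1))^-1 = 1 &
    (p / (p - 1))^-1 * p = p - 1].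
Proof.
move=> p1; have p0 : 0 < p by lra.
have p10 : 0 < p - 1 by lra.
split => //; first by rewrite divr_gt0.
  by rewrite invf_div; field; exact: lt0r_neq0.
by rewrite invf_div divfK// lt0r_neq0.
Qed.

Section integral_inequalities.
Context d (T : measurableType d) (R : realType).
Variable mu : {measure set T -> \bar R}.
Local Open Scope ereal_scope.

Import HBNNSimple.

(* Unlike [ge0_le_integral], no measurability: it spares that of the
   K-functional in [t]. *)
Lemma ge0_le_integral_nonmeasurable (D : set T) (f g : T -> \bar R) :
  (forall x, D x -> 0 <= f x) -> (forall x, D x -> f x <= g x) ->
  \int[mu]_(x in D) f x <= \int[mu]_(x in D) g x.
Proof.
move=> f0 fg; have g0 x : D x -> 0 <= g x by move=> Dx; exact: le_trans (f0 x Dx) (fg x Dx).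
rewrite !ge0_integralE//; apply: le_ereal_sup => _ [h hf <-].
exists h => // x; apply: le_trans (hf x) _.
by rewrite !patchE; case: ifPn => // /set_mem; exact: fg.
Qed.

(** Hoelder's inequality for the product of [f] restricted to [B] with the indicator of [B]; the
    conjugate exponent [p / (p - 1)] produces the power [p - 1] of the measure. *)
Lemma powR_integral_le (B : set T) (f : T -> R) (p m : R) :
  measurable B -> mu B = m%:E -> measurable_fun setT f ->
  (forall x, 0 <= f x)%R -> (1 < p)%R ->
  (\int[mu]_(x in B) (f x)%:E) `^ p <=
  (m `^ (p - 1))%:E * \int[mu]_(x in B) (f x `^ p)%:E.
Proof.
move=> mB Bm mf f0 p1.
have [p0 q0 pq qp] := conjugate_exponentE p1.
have m0 : (0 <= m)%R by rewrite -lee_fin -Bm.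
set q := (p / (p - 1))%R in q0 pq qp.
pose g x := (f x * \1_B x)%R.
have m1B : measurable_fun setT (\1_B : T -> R) by exact: measurable_indic.
have mg : measurable_fun setT g by exact: measurable_funM.
have := hoelder mu mg m1B p0 q0 pq.
have -> : 'N[mu]_1[EFin \o (g \* \1_B)%R] = \int[mu]_(x in B) (f x)%:E.
  rewrite Lnorm1 [RHS]integral_mkcond; apply: eq_integral => x _.
  rewrite /g /= patchE indicE; case: (x \in B); rewrite ?mulr1 ?mulr0 ?normr0//.
  by rewrite ger0_norm.
have -> : 'N[mu]_q%:E[EFin \o \1_B] = (m `^ q^-1)%:E.
  rewrite unlock /= -poweR_EFin -Bm; congr (_ `^ _).
  transitivity (\int[mu]_x (\1_B x)%:E); last by rewrite integral_indic// setIT.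
  apply: eq_integral => x _; rewrite /= indicE; case: (x \in B); first by rewrite normr1 powR1.
  by rewrite normr0 powR0// gt_eqF.
move=> /(gt0_ler_poweR (ltW p0)) h.
apply: le_trans (h _ _) _.
  by rewrite in_itv/= leey andbT; apply: integral_ge0 => x _; rewrite lee_fin.
  by rewrite in_itv/= leey andbT mule_ge0 ?Lnorm_ge0 ?lee_fin ?powR_ge0.
rewrite poweRM ?Lnorm_ge0 ?lee_fin ?powR_ge0// muleC.
rewrite poweR_EFin -powRrM qp.
rewrite poweR_Lnorm; last by rewrite gt_eqF.
apply: lee_wpmul2l; first by rewrite lee_fin powR_ge0.
rewrite [leRHS]integral_mkcond.
rewrite le_eqVlt; apply/orP; left; apply/eqP; apply: eq_integral => x _.
rewrite /g /= patchE indicE; case: (x \in B); rewrite ?mulr1 ?mulr0.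
  by rewrite ger0_norm.
by rewrite normr0 powR0// gt_eqF.
Qed.

End integral_inequalities.

Section K_upper.
Context {R : realType} {N : nat}.
Implicit Types (u v g : 'rV[R]_N -> R) (Omega B : set 'rV[R]_N).
Local Open Scope ereal_scope.

Lemma shift_energy_ge0 u (p t : R) : 0 <= shift_energy u p t.
Proof.
apply: integral_ge0 => x _; apply: integral_ge0 => h _.
by rewrite lee_fin mulr_ge0// powR_ge0.
Qed.

(** Hoelder on [B] bounds the [p]-th power of the oscillation by [m ^ (p - 1)] times the integral
    over [B] of [|u (x + h) - u x| ^ p]. Since [B] lies in the Euclidean ball of radius [t],
    integrating in [x] gives the shift energy. *)
Lemma Lp_norm_le_shift_energy Omega B u g (p m a t : R) :
  (1 < p)%R -> measurable B -> leb N B = m%:E ->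
  (forall h, B h -> enorm h < t)%R -> test_fun u -> (0 <= a)%R ->
  (forall x, `|g x| <= a * oscillation B u x)%R ->
  Lp_norm Omega p g <=
    a%:E * ((m `^ (p - 1))%:E * shift_energy u p t) `^ p^-1.
Proof.
move=> p1 mB Bm Bt tu a0 gosc.
have p0 : (0 < p)%R by exact: lt_trans p1.
have m0 : (0 <= m)%R by rewrite -lee_fin -Bm; exact: measure_ge0.
have Boo : leb N B < +oo by rewrite Bm ltry.
have mg : measurable_fun setT (fun z : 'rV[R]_N * 'rV[R]_N =>
    ((enorm z.2 < t)%R%:R * `|u (z.1 + z.2) - u z.1| `^ p)%:E).
  apply/measurable_EFinP; apply: measurable_funM.
    exact: measurable_enorm_lt.
  by apply: measurable_shift_powR => //; exact: measurable_test_fun.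
have mE : measurable_fun setT (fun x : 'rV[R]_N => \int[leb N]_h
    ((enorm h < t)%R%:R * `|u (x + h) - u x| `^ p)%:E).
  apply: (measurable_fun_fubini_tonelli_F _ mg) => z.
  by rewrite lee_fin mulr_ge0// powR_ge0.
have E0 x : 0 <= \int[leb N]_h
    ((enorm h < t)%R%:R * `|u (x + h) - u x| `^ p)%:E.
  by apply: integral_ge0 => h _; rewrite lee_fin mulr_ge0// powR_ge0.
have c0 : (0 <= a `^ p * m `^ (p - 1))%R by rewrite mulr_ge0// powR_ge0.
have C0 : 0 <= (a `^ p * m `^ (p - 1))%:E * shift_energy u p t.
  by rewrite mule_ge0// shift_energy_ge0.
have -> : a%:E * ((m `^ (p - 1))%:E * shift_energy u p t) `^ p^-1 =
    ((a `^ p * m `^ (p - 1))%:E * shift_energy u p t) `^ p^-1.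
  rewrite EFinM -muleA [RHS]poweRM ?lee_fin ?powR_ge0//; last first.
    by rewrite mule_ge0 ?shift_energy_ge0 ?lee_fin ?powR_ge0.
  by rewrite poweR_EFin -powRrM mulfV ?gt_eqF// powRr1.
rewrite /Lp_norm unlock /=; apply: gt0_ler_poweR.
- by rewrite invr_ge0 ltW.
- by rewrite in_itv/= leey andbT integral_ge0// => x _; exact: poweR_ge0.
- by rewrite in_itv/= leey andbT.
rewrite /shift_energy -ge0_integralZl_EFin//.
apply: ge0_le_integral_nonmeasurable => x _; first exact: poweR_ge0.
apply: (@le_trans _ _ (`|g x| `^ p)%:E).
  rewrite patchE; case: ifPn => _ //=.
  by rewrite normr0 powR0 ?gt_eqF// lee_fin powR_ge0.
apply: (@le_trans _ _ ((a * oscillation B u x) `^ p)%:E).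
  rewrite lee_fin; apply: ge0_ler_powR; rewrite ?nnegrE//; first exact: ltW.
  exact: le_trans (normr_ge0 _) (gosc x).
rewrite powRM//; last exact: Rintegral_ge0.
rewrite 2!EFinM -muleA; apply: lee_wpmul2l; first by rewrite lee_fin powR_ge0.
have iB := integrable_norm (@integrable_shift_sub _ _ B u x mB Boo tu).
have -> : (oscillation B u x `^ p)%:E =
    (\int[leb N]_(h in B) (`|u (x + h) - u x|)%:E) `^ p.
  rewrite -poweR_EFin /oscillation /Rintegral fineK//.
  exact: integrable_fin_num.
have mu1 : measurable_fun setT (fun h => `|u (x + h) - u x|)%R.
  apply: measurableT_comp => //; apply: measurable_funB => //.
  apply: (measurableT_comp (measurable_test_fun tu)).
  exact: measurable_rV_add.
apply: le_trans (powR_integral_le mB Bm mu1 _ p1) _ => //.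
apply: lee_wpmul2l; first by rewrite lee_fin powR_ge0.
rewrite integral_mkcond; apply: ge0_le_integral_nonmeasurable => h _.
  by rewrite patchE; case: ifPn => // _; rewrite lee_fin powR_ge0.
rewrite patchE; case: ifPn => [/set_mem/Bt ->|_]; first by rewrite mul1r.
by rewrite lee_fin mulr_ge0// powR_ge0.
Qed.

End K_upper.

Section K_functional_upper.
Context {R : realType} {N : nat}.
Implicit Types (u v : 'rV[R]_N -> R) (Omega : set 'rV[R]_N).

(** With [rho = t r / 2], the first factor collects the amplitude [2 / rho ^ n] of the bump and the
    gradient term, the second comes from Hoelder on a cube of volume [(4 rho) ^ n]. The powers of
    [rho] combine to [- n p + n (p - 1) = - n], which leaves [(2 / r) ^ n] and the factor
    [t ^ (- n)] of [upper_constE]. *)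
Definition upper_const (n : nat) (p r : R) : R :=
  (2 * (1 + 2 * n%:R / r)) `^ p * (4 ^+ n) `^ (p - 1) * (2 / r) ^+ n.

Lemma upper_const_gt0 n (p r : R) : 0 < r -> 0 < upper_const n p r.
Proof.
move=> r0; rewrite !mulr_gt0 ?exprn_gt0 ?divr_gt0// powR_gt0// ?exprn_gt0//.
by rewrite mulr_gt0// ltr_pwDl// divr_ge0 ?mulr_ge0// ltW.
Qed.

Lemma upper_constE n (p r t : R) : 0 < r -> 0 < t -> 1 < p ->
  ((1 + 2 * n%:R / r) * (2 / (t * r / 2) ^+ n)) `^ p *
    ((2 * (2 * (t * r / 2))) ^+ n) `^ (p - 1) =
  upper_const n p r * t `^ (- n%:R).
Proof.
move=> r0 t0 p1; set D := 1 + _; set rho := t * r / 2.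
have rho0 : 0 < rho by rewrite divr_gt0// mulr_gt0.
have D0 : 0 <= D by rewrite addr_ge0// divr_ge0 ?mulr_ge0// ltW.
pose x := rho ^+ n; have x0 : 0 < x by rewrite exprn_gt0.
have E : (2 * (2 * rho)) ^+ n = 4 ^+ n * x.
  by rewrite -exprMn; congr (_ ^+ n); ring.
rewrite E -/x mulrA [D * 2]mulrC (powRM _ (_ : 0 <= 2 * D))//; last 2 first.
  by rewrite mulr_ge0.
  by rewrite invr_ge0 ltW.
rewrite [(4 ^+ n * x) `^ _]powRM ?exprn_ge0 ?(ltW x0)//.
rewrite /upper_const -/D -!mulrA; congr (_ * _).
rewrite mulrCA; congr (_ * _).
rewrite -{1}powR_inv1 ?ltW// -powRrM mulN1r -powRD; last first.
  by apply/implyP => _; rewrite gt_eqF.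
rewrite (_ : - p + (p - 1) = -1) ?powR_inv1 ?ltW//; last by ring.
rewrite powR_invn ?ltW// /x -!exprVn -exprMn /rho; congr (_ ^+ n).
  by field; rewrite !gt_eqF.
exact: ltW.
Qed.

Lemma K_functional_le Omega u (c : 'rV[R]_N) (p r t : R) :
  1 < p -> 0 < r -> 0 < t -> C0infty Omega u ->
  (forall y h, Omega y -> `|h - c| <= t * r / 2 -> Omega (y - h)) ->
  (forall h, ball c (t * r) h -> enorm h < t) ->
  (K_functional t p Omega u `^ p <=
    (upper_const N p r * t `^ (- N%:R))%:E * shift_energy u p t)%E.
Proof.
move=> p1 r0 t0 uC HO HB; set rho := t * r / 2.
have rho0 : 0 < rho by rewrite divr_gt0// mulr_gt0.
have p0 : 0 < p by exact: lt_trans p1.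
(* The doubled cube on which the oscillation is taken is exactly the cube of radius [t r] assumed to
   lie in the Euclidean ball of radius [t]. *)
have rhoE : t * r = 2 * rho by rewrite /rho; field.
pose phi := unit_tent c rho.
have tu : test_fun u by case: uC => ? [].
have iphi : integrable_kernel phi by exact: integrable_unit_tent.
pose v := correlation phi u.
have vC : C0infty Omega v.
  apply: (correlation_supp iphi uC _ HO) => h hc.
  by apply: unit_tent_eq0; exact: ltW.
pose B : set 'rV[R]_N := ball c (2 * rho).
pose A := 2 / rho ^+ N; pose L := 2 / rho ^+ N.+1.
have A0 : 0 <= A by rewrite divr_ge0// exprn_ge0// ltW.
have L0 : 0 <= L by rewrite divr_ge0// exprn_ge0// ltW.
have osc0 x : 0 <= oscillation B u x by exact: Rintegral_ge0.
have h1 x : `|u x - v x| <= A * oscillation B u x.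
  rewrite distrC; apply: correlation_approx => //.
  - exact: unit_tent_le.
  - exact: unit_tent_eq0.
  - exact: integral_unit_tent.
have h2 x : `|enorm (grad v x)| <= N%:R * L * oscillation B u x.
  rewrite ger0_norm ?enorm_ge0//; apply: le_trans (enorm_le_norm _) _.
  rewrite -mulrA ler_wpM2l//; apply/rV_norm_leP => [|i]; first exact: mulr_ge0.
  rewrite mxE; apply: (@correlation_partial_le _ _ _ phi c rho) => //.
  - exact: unit_tent_lipschitz.
  - exact: unit_tent_eq0.
have mB : measurable B by exact: measurable_rV_ball.
have Bm : leb N B = ((2 * (2 * rho)) ^+ N)%:E by rewrite /B leb_ball// mulr_gt0.
have BT h : B h -> enorm h < t by rewrite /B -rhoE; exact: HB.
have l1 := @Lp_norm_le_shift_energy R N Omega B u _ p _ _ t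
  p1 mB Bm BT tu A0 h1.
have NL0 : 0 <= N%:R * L by rewrite mulr_ge0.
have l2 := @Lp_norm_le_shift_energy R N Omega B u _ p _ _ t
  p1 mB Bm BT tu NL0 h2.
set W := (_ `^ p^-1)%E in l1 l2.
have W0 : (0 <= W)%E by exact: poweR_ge0.
(* The summand [1] comes from [u - v]. The gradient contributes [t N L], which equals [(2 N / r) A]
   because [L = A / rho] and [t / rho = 2 / r]. *)
have Kle : (K_functional t p Omega u <= ((1 + 2 * N%:R / r) * A)%:E * W)%E.
  apply: (@le_trans _ _ (Lp_norm Omega p (fun x => (u x - v x)%R) +
      t%:E * Lp_norm Omega p (fun x => enorm (grad v x)))%E).
    by apply: ereal_inf_lbound; exists v.
  apply: (@le_trans _ _ (A%:E * W + t%:E * ((N%:R * L)%:E * W))%E).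
    by apply: leeD => //; apply: lee_wpmul2l; rewrite ?lee_fin ?(ltW t0).
  have tL0 : 0 <= t * (N%:R * L) by rewrite mulr_ge0// ltW.
  rewrite muleA -EFinM -ge0_muleDl ?lee_fin//.
  rewrite (_ : (A%:E + _)%E = ((1 + 2 * N%:R / r) * A)%:E)//.
  rewrite -[LHS]/(A + t * (N%:R * L))%:E; congr EFin.
  have : 0 < rho ^+ N by rewrite exprn_gt0.
  rewrite /L /A exprS; set y := rho ^+ N => y0; rewrite /rho; field.
  by rewrite !gt_eqF.
have K0 : (0 <= K_functional t p Omega u)%E.
  apply/ereal_infP => _ [w _ <-].
  by rewrite adde_ge0 ?mule_ge0 ?Lnorm_ge0// lee_fin ltW.
apply: (@le_trans _ _ ((((1 + 2 * N%:R / r) * A)%:E * W) `^ p)%E).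
  apply: gt0_ler_poweR => //; rewrite ?in_itv/= ?leey ?andbT ?(ltW p0)//.
  by apply: le_trans Kle.
have DA0 : 0 <= (1 + 2 * N%:R / r) * A.
  by rewrite mulr_ge0// addr_ge0// divr_ge0 ?mulr_ge0// ltW.
rewrite poweRM ?lee_fin// poweR_EFin /W -poweRrM mulVf ?gt_eqF//.
rewrite poweRe1; last by rewrite mule_ge0 ?lee_fin ?powR_ge0 ?shift_energy_ge0.
by rewrite muleA -EFinM upper_constE.
Qed.

End K_functional_upper.

(** * Lower bound of the K-functional *)

Section power_sums.
Context {R : realType}.

(** The sum is at most [n] times its largest term, whose power is one of the summands on the right;
    no convexity is involved. *)
Lemma powR_sum_le n (a : 'I_n -> R) (p : R) : 0 < p -> (forall i, 0 <= a i) ->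
  (\sum_i a i) `^ p <= n%:R `^ p * \sum_i a i `^ p.
Proof.
move=> p0 a0; case: n a a0 => [a a0|n a a0].
  by rewrite !big_ord0 powR0 ?gt_eqF// mulr0.
have [j _ jmax] := @arg_maxP _ _ _ ord0 xpredT a erefl.
have le1 : \sum_i a i <= n.+1%:R * a j.
  rewrite mulr_natl -[X in _ *+ X](card_ord n.+1) -sumr_const.
  by apply: ler_sum => i _; exact: jmax.
apply: (@le_trans _ _ ((n.+1%:R * a j) `^ p)).
  by rewrite ge0_ler_powR ?nnegrE ?sumr_ge0 ?mulr_ge0// ltW.
rewrite powRM// ler_wpM2l ?powR_ge0//.
by rewrite (bigD1 j)//= lerDl sumr_ge0// => i _; exact: powR_ge0.
Qed.

Lemma powR_add_le (a b p : R) : 0 < p -> 0 <= a -> 0 <= b ->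
  (a + b) `^ p <= 2 `^ p * (a `^ p + b `^ p).
Proof.
move=> p0 a0 b0.
have := @powR_sum_le 2 (fun i => if i == ord0 then a else b) p p0.
rewrite !big_ord_recl !big_ord0 /= !addr0; apply => i.
by case: ifP.
Qed.

End power_sums.

(** * Increments along a coordinate axis *)

Section shift_partial.
Context {R : realType} {N : nat}.
Implicit Types (u v : 'rV[R]_N -> R) (x y h : 'rV[R]_N) (i : 'I_N).

Local Notation e i := (delta_mx ord0 i : 'rV[R]_N).
Local Open Scope ereal_scope.

Lemma test_fun_line_continuous v x i : test_fun v ->
  continuous (fun r : R => v (x + r *: e i)%R).
Proof.
move=> tv r; apply: differentiable_continuous; apply/derivable1_diffP.
by have [] := is_derive_line (@test_fun_derivable _ _ v (x + r *: e i) i tv).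
Qed.

(** The fundamental theorem of calculus on the line through [x], then Hoelder on an interval of
    length [t]. *)
Lemma increment_le_integral v x i (t p : R) : test_fun v -> (0 < t)%R -> (1 < p)%R ->
  (`|v (x + t *: e i) - v x| `^ p)%:E <=
  (t `^ (p - 1))%:E *
    \int[lebesgue_measure]_(r in `[0%R, t]) (`|partial i v (x + r *: e i)| `^ p)%:E.
Proof.
move=> tv t0 p1.
have p0 : (0 < p)%R by exact: lt_trans p1.
pose g (r : R) := partial i v (x + r *: e i).
have cg : continuous g by exact/test_fun_line_continuous/test_fun_partial.
have mg : measurable_fun setT g by exact: continuous_measurable_fun.
have cv := @test_fun_line_continuous v x i tv.
have FTC : \int[lebesgue_measure]_(r in `[0%R, t]) (g r)%:E =
    (v (x + t *: e i))%:E - (v x)%:E.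
  rewrite (@continuous_FTC2 _ g (fun r => v (x + r *: e i)) 0 t)%R ?scale0r ?addr0//.
  - exact: continuous_subspaceT.
  - split.
    + move=> r _.
      by have [] := is_derive_line (@test_fun_derivable _ _ v (x + r *: e i) i tv).
    + by apply: cvg_at_right_filter; exact: cv.
    + by apply: cvg_at_left_filter; exact: cv.
  - move=> r _; rewrite derive1E.
    by have [_ ->] := is_derive_line (@test_fun_derivable _ _ v (x + r *: e i) i tv).
have mB : measurable (`[0%R, t]%classic : set (measurableTypeR R)) by exact: measurable_itv.
have Bt : lebesgue_measure (`[0%R, t]%classic : set R) = t%:E.
  by rewrite lebesgue_measure_itv/= lte_fin t0 sube0.
apply: le_trans (@powR_integral_le _ (measurableTypeR R) R lebesgue_measure _
  (fun r => `|g r|%R) p t mB Bt _ _ p1) => //; last exact: measurableT_comp.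
rewrite -poweR_EFin; apply: gt0_ler_poweR; rewrite ?(ltW p0)//.
- by rewrite in_itv/= leey andbT.
- by rewrite in_itv/= leey andbT integral_ge0.
have := @le_abse_integral _ _ R lebesgue_measure `[0%R, t]%classic (EFin \o g) mB.
rewrite FTC; apply.
by apply/measurable_EFinP; exact: measurable_funTS.
Qed.

Lemma measurable_shift_line i :
  measurable_fun setT (fun z : 'rV[R]_N * measurableTypeR R => z.1 + (z.2 : R) *: e i)%R.
Proof.
apply: measurable_rV_add => //; apply: measurable_fun_rV => j.
apply: (eq_measurable_fun (fun z : 'rV[R]_N * measurableTypeR R => (z.2 : R) * e i ord0 j)%R).
  by move=> z _; rewrite [RHS]mxE.
by apply: measurable_funM => //; exact: measurable_snd.
Qed.

(** Integrate the one-dimensional bound in [x] and exchange the integrals: by translation invariance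
    every [r] in [[0, t]] contributes the same amount, so that [t ^ (p - 1)] is multiplied by
    [t]. *)
Lemma shift_partial_le v i (t p : R) : test_fun v -> (1 < p)%R ->
  \int[leb N]_x (`|v (x + t *: e i) - v x| `^ p)%:E <=
  (`|t| `^ p)%:E * \int[leb N]_x (`|partial i v x| `^ p)%:E.
Proof.
move=> tv p1.
have p0 : (0 < p)%R by exact: lt_trans p1.
have mv := measurable_test_fun tv.
have mdv := measurable_test_fun (test_fun_partial i tv).
have md0 (r : R) : measurable_fun setT (fun x => (`|v (x + r *: e i) - v x| `^ p)%:E).
  by apply/measurable_EFinP; exact: measurable_shift_powR.
(* For negative [t], translating [x] by [- t *: e i] exchanges the two end points of the
   increment. *)
wlog t0 : t / (0 < t)%R.
  move=> H; have [t0|t0|<-] := ltgtP 0%R t.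
  - exact: H.
  - rewrite -(@ge0_integral_leb_shift _ _ (- t *: e i))//.
    rewrite -normrN; apply: le_trans (H _ _); last by rewrite oppr_gt0.
    rewrite le_eqVlt; apply/orP; left; apply/eqP; apply: eq_integral => x _.
    by rewrite -addrA -scalerDl addNr scale0r addr0 distrC.
  - rewrite normr0 powR0 ?gt_eqF// mul0e le_eqVlt; apply/orP; left; apply/eqP.
    apply: integral0_eq => x _.
    by rewrite scale0r addr0 subrr normr0 powR0// gt_eqF.
have m1 : measurable_fun setT (\1_`[0%R, t]%classic : measurableTypeR R -> R).
  by apply: measurable_indic; exact: measurable_itv.
pose f (z : 'rV[R]_N * measurableTypeR R) :=
  (\1_`[0%R, t]%classic z.2 * `|partial i v (z.1 + z.2 *: e i)| `^ p)%R.
have f0 z : 0 <= (f z)%:E by rewrite lee_fin mulr_ge0 ?powR_ge0.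
have mf : measurable_fun setT (fun z => (f z)%:E).
  apply/measurable_EFinP; apply: measurable_funM.
    exact: (measurableT_comp m1 measurable_snd).
  apply: (measurableT_comp (measurable_powR _)).
  apply: measurableT_comp => //.
  by apply: (measurableT_comp mdv); exact: measurable_shift_line.
have mF := @measurable_fun_fubini_tonelli_F _ _ _ _ R lebesgue_measure _ mf f0.
apply: (@le_trans _ _ (\int[leb N]_x ((t `^ (p - 1))%:E *
    \int[lebesgue_measure]_r (f (x, r))%:E))).
  apply: ge0_le_integral => //.
  - exact: measurable_funeM.
  - move=> x _; apply: le_trans (increment_le_integral x i tv t0 p1) _.
    apply: lee_wpmul2l; first by rewrite lee_fin powR_ge0.
    rewrite integral_mkcond le_eqVlt; apply/orP; left; apply/eqP.
    apply: eq_integral => r _; rewrite patchE /f /= indicE.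
    by case: (r \in _); rewrite ?mul1r ?mul0r.
rewrite ge0_integralZl_EFin//; last 2 first.
  by move=> x _; exact: integral_ge0.
  exact: powR_ge0.
rewrite (@fubini_tonelli _ _ _ _ R (leb N) lebesgue_measure _ mf f0).
rewrite (gtr0_norm t0) -(@mulr_powRB1 _ t p) ?(ltW t0)// [(t * _)%R]mulrC EFinM -muleA.
apply: lee_wpmul2l; first by rewrite lee_fin powR_ge0.
set Q := \int[leb N]_x _.
pose G x := (`|partial i v x| `^ p)%:E.
have g0 x : 0 <= G x by rewrite lee_fin powR_ge0.
have mG : measurable_fun setT G.
  apply/measurable_EFinP; apply: (measurableT_comp (measurable_powR _)).
  exact: measurableT_comp.
have mgr r : measurable_fun setT (fun x => G (x + r *: e i)%R).
  exact: (measurableT_comp mG (measurable_rV_addr _)).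
rewrite (_ : \int[_]_y _ = \int[lebesgue_measure]_r ((\1_`[0%R, t]%classic r)%:E * Q)).
  rewrite ge0_integralZr//; last 2 first.
  - by move/measurable_EFinP : m1.
  - by apply: integral_ge0 => x _; rewrite lee_fin powR_ge0.
  rewrite integral_indic//= setIT lebesgue_measure_itv/= lte_fin t0 sube0.
  exact: lexx.
apply: eq_integral => r _; rewrite /Q -(ge0_integral_leb_shift (r *: e i) mG g0).
have k0 : (0 <= (\1_`[0%R, t]%classic (r : R) : R))%R by [].
rewrite -(@ge0_integralZl_EFin _ _ R (leb N) setT measurableT
  (fun x => G (x + (r : R) *: e i)%R) (fun x _ => g0 _) (mgr r) _ k0).
by apply: eq_integral => x _; rewrite /G -EFinM.
Qed.

End shift_partial.

Section K_functional_lower.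
Context {R : realType} {N : nat}.
Implicit Types (u v g : 'rV[R]_N -> R) (x y h : 'rV[R]_N) (Omega : set 'rV[R]_N).

Local Open Scope ereal_scope.

Let Ip (p : R) g : \bar R := \int[leb N]_x (`|g x| `^ p)%:E.

Let Ip_ge0 p g : 0 <= Ip p g.
Proof. by apply: integral_ge0 => x _; rewrite lee_fin powR_ge0. Qed.

Lemma Lp_norm_powR Omega (p : R) g : (0 < p)%R ->
  (forall x, ~ Omega x -> g x = 0%R) ->
  Lp_norm Omega p g `^ p = \int[leb N]_x (`|g x| `^ p)%:E.
Proof.
move=> p0 g0; rewrite poweR_Lnorm ?gt_eqF//; apply: eq_integral => x _.
rewrite patchE; case: ifPn => //; rewrite notin_setE => /g0 ->.
by rewrite /= normr0.
Qed.

Let measurable_Ip (p : R) g : measurable_fun setT g ->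
  measurable_fun setT (fun x => (`|g x| `^ p)%:E).
Proof.
move=> mg; apply/measurable_EFinP; apply: (measurableT_comp (measurable_powR _)).
exact: measurableT_comp.
Qed.

(** Write [u = w + v] with [w = u - v]. The two values of [w] have the same integral by translation
    invariance, and [v] is telescoped along the staircase path, each step having length at most [t].
    One factor [2 ^ p] separates [w] from [v], the other one separates the two values of [w];
    [N ^ p] separates the [N] steps. *)
Lemma shift_powR_le u v (p t : R) h : test_fun u -> test_fun v -> (1 < p)%R ->
  (enorm h < t)%R ->
  \int[leb N]_x (`|u (x + h) - u x| `^ p)%:E <=
  (2 * (2 `^ p * 2 `^ p) + N%:R * (2 `^ p * N%:R `^ p))%:E *
    (\int[leb N]_x (`|u x - v x| `^ p)%:E +
     (t `^ p)%:E * \int[leb N]_x (`|enorm (grad v x)| `^ p)%:E).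
Proof.
move=> tu tv p1 ht.
have p0 : (0 < p)%R by exact: lt_trans p1.
have t0 : (0 < t)%R by apply: le_lt_trans ht; exact: enorm_ge0.
have mu := measurable_test_fun tu; have mv := measurable_test_fun tv.
have mdv i := measurable_test_fun (test_fun_partial i tv).
pose w x := (u x - v x)%R.
have mw : measurable_fun setT w by exact: measurable_funB.
pose D (i : 'I_N) x := (v (x + row_prefix i h + h ord0 i *: delta_mx ord0 i) -
  v (x + row_prefix i h))%R.
have mD i : measurable_fun setT (D i).
  apply: measurable_funB; apply: (measurableT_comp mv).
    apply: measurable_rV_add; [exact: measurable_rV_addr|exact: measurable_cst].
  exact: measurable_rV_addr.
have mwh : measurable_fun setT (fun x => w (x + h)%R).
  exact: (measurableT_comp mw (measurable_rV_addr _)).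
have mG : measurable_fun setT (fun x => enorm (grad v x)).
  apply: (measurableT_comp measurable_enorm); apply: measurable_fun_rV => i.
  apply: (eq_measurable_fun (partial i v)); first by move=> x _; rewrite mxE.
  exact: mdv.
set P := \int[leb N]_x (`|u x - v x| `^ p)%:E.
set Q := \int[leb N]_x (`|enorm (grad v x)| `^ p)%:E.
have PE : P = Ip p w by [].
have DQ i : Ip p (D i) <= (t `^ p)%:E * Q.
  rewrite /Ip /D.
  rewrite (@ge0_integral_leb_shift R N (row_prefix i h)
    (fun x => (`|v (x + h ord0 i *: delta_mx ord0 i)%R - v x| `^ p)%:E)); last 2 first.
  - by apply/measurable_EFinP; exact: measurable_shift_powR.
  - by move=> x; rewrite lee_fin powR_ge0.
  apply: le_trans (shift_partial_le _ _ tv p1) _.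
  apply: lee_pmul; rewrite ?lee_fin ?powR_ge0 ?Ip_ge0//.
  - rewrite ge0_ler_powR ?nnegrE ?(ltW p0) ?(ltW t0)//.
    apply: le_trans (rV_coord_le _ _) _.
    exact: le_trans (norm_le_enorm _) (ltW ht).
  - apply: ge0_le_integral => //.
    + by apply: measurable_Ip; exact: mdv.
    + exact: measurable_Ip.
    + move=> x _; rewrite lee_fin ge0_ler_powR ?nnegrE ?(ltW p0)//.
      rewrite [leRHS]ger0_norm ?enorm_ge0//.
      apply: le_trans (norm_le_enorm _).
      by have := rV_coord_le (grad v x) i; rewrite mxE.
set c1 := (2 `^ p * 2 `^ p)%R; set c2 := (2 `^ p * N%:R `^ p)%R.
have c10 : (0 <= c1)%R by rewrite mulr_ge0// powR_ge0.
have c20 : (0 <= c2)%R by rewrite mulr_ge0// powR_ge0.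
have pw x : (`|u (x + h) - u x| `^ p <=
    c1 * `|w (x + h)| `^ p + c1 * `|w x| `^ p + \sum_i c2 * `|D i x| `^ p)%R.
  apply: (@le_trans _ _ (((`|w (x + h)| + `|w x|) + \sum_i `|D i x|) `^ p)%R).
    rewrite ge0_ler_powR ?nnegrE ?(ltW p0) ?addr_ge0 ?sumr_ge0//.
    rewrite (_ : u (x + h) - u x = (w (x + h) - w x) + (v (x + h) - v x))%R; last first.
      by rewrite /w; ring.
    apply: le_trans (ler_normD _ _) _; apply: lerD; first exact: ler_normB.
    by rewrite telescope_row; exact: ler_norm_sum.
  apply: le_trans (powR_add_le p0 _ _) _; rewrite ?addr_ge0 ?sumr_ge0//.
  rewrite -mulrDr -mulr_sumr /c1 /c2 -!mulrA -mulrDr.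
  rewrite ler_wpM2l ?powR_ge0//; apply: lerD; first exact: powR_add_le.
  exact: powR_sum_le.
have e0 (g : 'rV[R]_N -> R) x : 0 <= (`|g x| `^ p)%:E by rewrite lee_fin powR_ge0.
have cZ (c : R) g : (0 <= c)%R -> measurable_fun setT g ->
    \int[leb N]_x (c * `|g x| `^ p)%:E = c%:E * Ip p g.
  move=> c0 mg; rewrite -ge0_integralZl_EFin//; exact: measurable_Ip.
have mcZ (c : R) g : measurable_fun setT g ->
    measurable_fun setT (fun x => (c * `|g x| `^ p)%:E).
  by move=> mg; exact: (measurable_funeM c%:E (measurable_Ip p mg)).
have cZ0 (c : R) g x : (0 <= c)%R -> 0 <= (c * `|g x| `^ p)%:E :> \bar R.
  by move=> c0; rewrite lee_fin mulr_ge0// powR_ge0.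
apply: (@le_trans _ _ (\int[leb N]_x ((c1 * `|w (x + h)%R| `^ p)%:E +
    (c1 * `|w x| `^ p)%:E + \sum_(i < N) (c2 * `|D i x| `^ p)%:E))).
  apply: ge0_le_integral_nonmeasurable => x _; first by rewrite lee_fin powR_ge0.
  by rewrite sumEFin -!EFinD lee_fin.
rewrite ge0_integralD//; last 4 first.
- by move=> x _; rewrite adde_ge0// cZ0.
- by apply: emeasurable_funD; exact: mcZ.
- by move=> x _; apply: sume_ge0 => i _; exact: cZ0.
- by apply: emeasurable_sum => i; exact: mcZ.
rewrite ge0_integralD//; last 4 first.
- by move=> x _; exact: cZ0.
- exact: (mcZ _ (fun x => w (x + h)%R)).
- by move=> x _; exact: cZ0.
- exact: mcZ.
rewrite ge0_integral_sum//; last 2 first.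
- by move=> i; exact: mcZ.
- by move=> i x _; exact: cZ0.
rewrite (cZ c1 (fun x => w (x + h)%R))// cZ//.
have -> : Ip p (fun x => w (x + h)%R) = P.
  rewrite PE; apply: (@ge0_integral_leb_shift R N h (fun x => (`|w x| `^ p)%:E)) => //.
  exact: measurable_Ip.
have tQ0 : 0 <= (t `^ p)%:E * Q by rewrite mule_ge0 ?Ip_ge0 ?lee_fin ?powR_ge0.
have P0 : 0 <= P by exact: Ip_ge0.
rewrite (ge0_muleDr _ P0 tQ0) -[Ip p w]/P. apply: leeD.
  rewrite (_ : c1%:E * P + c1%:E * P = (c1 + c1)%:E * P); last first.
    by rewrite EFinD ge0_muleDl ?lee_fin.
  apply: lee_wpmul2r; first exact: P0.
  by rewrite lee_fin mulr2n mulrDl mul1r lerDl mulr_ge0.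
apply: (@le_trans _ _ (\sum_(i < N) c2%:E * ((t `^ p)%:E * Q))).
  apply: lee_sum => i _; rewrite cZ//.
  by apply: lee_wpmul2l; rewrite ?lee_fin.
have -> : \sum_(i < N) c2%:E * ((t `^ p)%:E * Q) = (N%:R * c2)%:E * ((t `^ p)%:E * Q).
  rewrite -ge0_sume_distrl => [|i _]; last by rewrite lee_fin.
  by rewrite sumEFin sumr_const card_ord mulr_natl.
apply: lee_wpmul2r => //; rewrite lee_fin lerDr mulr_ge0//.
Qed.

(** The middle factor is that of [shift_powR_le]; [2 ^ N] comes from the volume of a cube containing
    the Euclidean ball of radius [t], and the last [2] from
    [a ^ p + (t b) ^ p <= 2 (a + t b) ^ p]. *)
Definition lower_const (p : R) : R :=
  (2 ^+ N * ((2 * (2 `^ p * 2 `^ p) + N%:R * (2 `^ p * N%:R `^ p)) * 2))%R.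

Lemma lower_const_gt0 (p : R) : (0 < lower_const p)%R.
Proof.
by rewrite mulr_gt0 ?exprn_gt0// mulr_gt0// ltr_pwDl.
Qed.

Lemma shift_energy_le_K Omega u (p t : R) : C0infty Omega u -> (1 < p)%R -> (0 < t)%R ->
  shift_energy u p t <= (lower_const p * t ^+ N)%:E * K_functional t p Omega u `^ p.
Proof.
move=> uC p1 t0; have p0 : (0 < p)%R by exact: lt_trans p1.
have tu : test_fun u by case: uC => ? [].
have C0 : (0 < lower_const p * t ^+ N)%R by rewrite mulr_gt0 ?lower_const_gt0 ?exprn_gt0.
set C := (lower_const p * t ^+ N)%R in C0 *.
have H (v : 'rV[R]_N -> R) : C0infty Omega v -> shift_energy u p t <= C%:E *
    (Lp_norm Omega p (fun x => u x - v x)%R +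
     t%:E * Lp_norm Omega p (fun x => enorm (grad v x))) `^ p.
  move=> vC; have tv : test_fun v by case: vC => ? [].
  set a := Lp_norm _ _ _; set b := Lp_norm _ _ _.
  have a0 : 0 <= a by exact: Lnorm_ge0.
  have b0 : 0 <= b by exact: Lnorm_ge0.
  have supp0 w x : C0infty Omega w -> ~ Omega x -> ~ supp w x.
    by move=> [_ [_ wO]] nO /wO.
  have out w x : C0infty Omega w -> ~ Omega x -> w x = 0%R.
    move=> wC nO; apply: contra_notP (supp0 _ _ wC nO) => /eqP wx.
    exact: subset_closure.
  have aE : a `^ p = \int[leb N]_x (`|u x - v x| `^ p)%:E.
    apply: Lp_norm_powR => // x nO.
    by rewrite (out _ _ uC nO) (out _ _ vC nO) subrr.
  have bE : b `^ p = \int[leb N]_x (`|enorm (grad v x)| `^ p)%:E.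
    apply: Lp_norm_powR => // x nO.
    rewrite (_ : grad v x = 0%R).
      by rewrite /enorm big1 ?sqrtr0// => i _; rewrite mxE expr0n.
    apply/rowP => i; rewrite !mxE; apply: partial_out_supp.
    exact: supp0.
  pose c := (2 * (2 `^ p * 2 `^ p) + N%:R * (2 `^ p * N%:R `^ p))%R.
  have c0 : (0 <= c)%R by rewrite addr_ge0 ?mulr_ge0 ?powR_ge0.
  pose S := a `^ p + (t `^ p)%:E * b `^ p.
  have S0 : 0 <= S by rewrite adde_ge0 ?mule_ge0 ?poweR_ge0 ?lee_fin ?powR_ge0.
  have mg : measurable_fun setT (fun z : 'rV[R]_N * 'rV[R]_N =>
      ((enorm z.2 < t)%R%:R * `|u (z.1 + z.2) - u z.1| `^ p)%:E).
    apply/measurable_EFinP; apply: measurable_funM.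
      exact: measurable_enorm_lt.
    by apply: measurable_shift_powR => //; exact: measurable_test_fun.
  have g0 (z : 'rV[R]_N * 'rV[R]_N) :
      0 <= ((enorm z.2 < t)%R%:R * `|u (z.1 + z.2) - u z.1| `^ p)%:E.
    by rewrite lee_fin mulr_ge0// powR_ge0.
  rewrite /shift_energy (@fubini_tonelli _ _ _ _ R (leb N) (leb N) _ mg g0).
  (* The bound on the [x]-integral is uniform in [h], so only the volume of the admissible [h] is
     left; it is estimated by that of the enclosing cube. *)
  pose B : set 'rV[R]_N := ball 0%R t.
  have mB : measurable B by exact: measurable_rV_ball.
  apply: (@le_trans _ _ (\int[leb N]_h ((\1_B h)%:E * (c%:E * S)))).
    apply: ge0_le_integral_nonmeasurable => h _; first exact: integral_ge0.
    have [ht|ht] := ltP (enorm h) t; last first.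
      rewrite integral0_eq ?mule_ge0 ?lee_fin// => x _.
      by rewrite mul0r.
    rewrite indicE mem_set; last first.
      rewrite /B mx_norm_ball /= sub0r normrN.
      exact: le_lt_trans (norm_le_enorm _) ht.
    rewrite mul1e /S aE bE; apply: le_trans (shift_powR_le tu tv p1 ht).
    rewrite le_eqVlt; apply/orP; left; apply/eqP; apply: eq_integral => x _.
    by rewrite mul1r.
  rewrite ge0_integralZr//; last 2 first.
    by apply/measurable_EFinP; exact: measurable_indic.
    by rewrite mule_ge0 ?lee_fin.
  have Bm : leb N B = ((2 * t) ^+ N)%:E by exact: leb_ball.
  rewrite integral_indic// setIT [X in X * _ <= _](_ : _ = leb N B)// Bm.
  have S2 : S <= 2%:E * (a + t%:E * b) `^ p.
    rewrite (_ : 2%:E = 1 + 1)// ge0_muleDl// mul1e; apply: leeD.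
      apply: gt0_ler_poweR; rewrite ?in_itv/= ?leey ?andbT ?(ltW p0)
        ?adde_ge0 ?mule_ge0 ?lee_fin ?(ltW t0)//.
      by rewrite leeDl// mule_ge0// lee_fin ltW.
    rewrite -poweR_EFin -poweRM ?lee_fin ?(ltW t0)//.
    apply: gt0_ler_poweR; rewrite ?in_itv/= ?leey ?andbT ?(ltW p0)
        ?adde_ge0 ?mule_ge0 ?lee_fin ?(ltW t0)//.
    by rewrite leeDr.
  apply: (@le_trans _ _ (((2 * t) ^+ N)%:E * (c%:E * (2%:E * (a + t%:E * b) `^ p)))).
    do 2 (apply: lee_wpmul2l; first by rewrite lee_fin ?exprn_ge0 ?mulr_ge0 ?(ltW t0)).
    exact: S2.
  rewrite !muleA -!EFinM le_eqVlt; apply/orP; left; apply/eqP; congr (_%:E * _).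
  by rewrite /C /lower_const -/c exprMn; ring.
have E0 := shift_energy_ge0 u p t.
suff : (C^-1%:E * shift_energy u p t) `^ p^-1 <= K_functional t p Omega u.
  move=> /(gt0_ler_poweR (ltW p0)) h.
  rewrite muleC -lee_pdivrMr//.
  apply: le_trans (h _ _).
  - rewrite -poweRrM mulVf ?gt_eqF// poweRe1 ?mule_ge0 ?lee_fin ?invr_ge0 ?(ltW C0)//.
    by rewrite muleC.
  - by rewrite in_itv/= leey andbT poweR_ge0.
  - rewrite in_itv/= leey andbT; apply/ereal_infP => _ [w _ <-].
    by rewrite adde_ge0 ?mule_ge0 ?Lnorm_ge0// lee_fin ltW.
apply/ereal_infP => _ [v vC <-].
set b := (_ + _); have b0 : 0 <= b.
  by rewrite adde_ge0 ?mule_ge0 ?Lnorm_ge0// lee_fin ltW.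
rewrite -[leRHS](poweRe1 b0) -(mulfV (lt0r_neq0 p0)) poweRrM.
apply: gt0_ler_poweR; rewrite ?in_itv/= ?leey ?andbT ?invr_ge0 ?(ltW p0) ?poweR_ge0//.
  by rewrite mule_ge0 ?lee_fin ?invr_ge0 ?(ltW C0).
rewrite muleC lee_pdivrMr// muleC; exact: H.
Qed.

End K_functional_lower.

(** * Cones and eccentricity *)

Section cones.
Context {R : realType} {N : nat}.
Implicit Types (x y z w h : 'rV[R]_N) (A Omega : set 'rV[R]_N).

(** The point is the midpoint of the dilations about [x0] of [y] by [2] and of [w] by [2 t]. *)
Lemma cone_add (x0 : 'rV[R]_N) Omega y w (t : R) : convex_cone x0 Omega ->
  Omega y -> Omega w -> 0 < t -> Omega (y + t *: (w - x0)).
Proof.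
move=> [cO coneO] Oy Ow t0.
have O1 : Omega (x0 + 2 *: (y - x0)) by exact: coneO.
have O2 : Omega (x0 + (2 * t) *: (w - x0)) by apply: coneO => //; rewrite mulr_gt0.
have h0 : (0 : R) <= 2^-1 by rewrite invr_ge0.
have h1 : 2^-1 <= 1 :> R by rewrite invf_le1// ler1n.
have := cO _ _ (Itv01 h0 h1) (mem_set O1) (mem_set O2).
move=> /set_mem; congr Omega.
rewrite [LHS](_ : _ = 2^-1 *: (x0 + 2 *: (y - x0)) +
  (1 - 2^-1) *: (x0 + (2 * t) *: (w - x0)))//.
by apply/rowP => i; rewrite !mxE; field.
Qed.

Lemma enormZ (a : R) x : enorm (a *: x) = `|a| * enorm x.
Proof.
rewrite -sqrtr_sqr -sqrtrM ?sqr_ge0// /enorm; congr Num.sqrt.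
by rewrite mulr_sumr; apply: eq_bigr => i _; rewrite mxE exprMn.
Qed.

(** The distance to the boundary is thus at most the distance to any point outside, so a ball around
    [x] of smaller radius stays in [A]. The boundary point is found at the supremum of the
    parameters for which the segment from [x] to [y] is in [A]. *)
Lemma segment_boundary A x y : A x -> ~ A y ->
  exists2 z, boundary A z & enorm (x - z) <= enorm (x - y).
Proof.
move=> Ax nAy; pose f (t : R) := x + t *: (y - x).
have xf t : x - f t = t *: (x - y).
  by rewrite /f opprD addrA subrr sub0r -scalerN opprB.
pose S : set R := [set t | 0 <= t <= 1 /\ A (f t)].
have S0 : S 0 by split; [rewrite lexx ler01|rewrite /f scale0r addr0].
have Sub : has_ubound S by exists 1 => t [/andP[]].
have supS : has_sup S by split => //; exists 0.
set t1 := sup S.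
have t10 : 0 <= t1 by exact: ub_le_sup.
have t11 : t1 <= 1 by apply: sup_le_ub; [exists 0|move=> t [/andP[]]].
have fball (t s e : R) : `|t - s| * `|y - x| < e -> ball (f t) e (f s).
  rewrite mx_norm_ball /= /f opprD addrACA subrr add0r -scalerBl normrZ.
  exact.
have small (e : R) : 0 < e -> exists2 d, 0 < d &
    forall t, `|t1 - t| <= d -> ball (f t1) e (f t).
  move=> e0; exists (e / (`|y - x| + 1)).
    by rewrite divr_gt0// ltr_wpDl.
  move=> t td; apply: fball.
  apply: (@le_lt_trans _ _ (e / (`|y - x| + 1) * `|y - x|)).
    by rewrite ler_wpM2r.
  by rewrite mulrAC ltr_pdivrMr ?ltr_wpDl// ltr_pM2l// ltrDl.
exists (f t1); last first.
  by rewrite xf enormZ ger0_norm// ler_piMl// enorm_ge0.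
split.
  move=> B /nbhs_ballP[e /= e0 eB]; have [d d0 dB] := small e e0.
  have [t St tt1] := sup_adherent d0 supS.
  exists (f t); split; first by case: St.
  apply: eB; apply: dB; rewrite ger0_norm; first by rewrite lerBlDr -lerBlDl ltW.
  by rewrite subr_ge0; exact: ub_le_sup.
move=> /nbhs_ballP[e /= e0 eA]; have [d d0 dB] := small e e0.
(* Were [f t1] interior, then either [t1 = 1] and [y] itself would be in [A], or a parameter
   slightly larger than [t1], capped at [1], would contradict the supremum. *)
have [t11'|t11'] := ltP t1 1; last first.
  have t1E : t1 = 1 by apply/eqP; rewrite eq_le t11.
  apply: nAy; have := eA (f t1) (ballxx _ e0).
  by rewrite /f t1E scale1r addrC subrK.
pose t := Num.min 1 (t1 + d).
have t1t : t1 < t by rewrite lt_min t11' ltrDl.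
have : t <= t1.
  apply: ub_le_sup => //; split.
    by rewrite (le_trans t10 (ltW t1t)) ge_min lexx.
  apply: eA; apply: dB; rewrite ltr0_norm ?subr_lt0// opprB lerBlDl.
  by rewrite ge_min lexx orbT.
by rewrite leNgt t1t.
Qed.

(* [ball] is a cube: it refers to the maximum norm, hence the factor [N]. *)
Lemma open_cone_cube (x0 : 'rV[R]_N) Omega : (0 < N)%N -> open Omega ->
  convex_cone x0 Omega -> Omega !=set0 ->
  let E := eccentricity (Omega `&` eball x0 1) in
  0 < E /\ exists c, forall h, ball c ((8 * E * N%:R)^-1) h ->
    Omega (x0 - h) /\ enorm h < 1.
Proof.
move=> N0 oO cO [y1 Oy1] /=; set A := Omega `&` _; set E := eccentricity A.
have n0 : 0 < N%:R :> R by rewrite ltr0n.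
have n1 : 1 <= N%:R :> R by rewrite ler1n.
pose i := Ordinal N0; pose ei : 'rV[R]_N := delta_mx ord0 i.
have nei : `|ei| = 1 by exact: norm_delta_rV.
(* A direction for a ray is needed; should the given point be the apex, openness allows a small move
   along [ei]. *)
have [y Oy yx0] : exists2 y, Omega y & y != x0.
  have [y1E|] := eqVneq y1 x0; last by exists y1.
  have /nbhs_ballP[ep /= ep0 epO] := open_nbhs_nbhs (conj oO Oy1).
  exists (y1 + (ep / 2) *: ei).
    apply: epO; rewrite mx_norm_ball /= opprD addrA subrr sub0r normrN normrZ.
    by rewrite nei mulr1 gtr0_norm ?divr_gt0// ltr_pdivrMr// ltr_pMr// ltr1n.
  rewrite -subr_eq0 y1E addrAC subrr add0r -normr_gt0 normrZ nei mulr1.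
  by rewrite gtr0_norm ?divr_gt0.
pose d := enorm (y - x0).
have d0 : 0 < d.
  by rewrite (lt_le_trans _ (norm_le_enorm _))// normr_gt0 subr_eq0.
pose pt (t : R) := x0 + (t / d) *: (y - x0).
have ptE (t : R) : 0 < t -> enorm (pt t - x0) = t.
  move=> t0; rewrite /pt addrAC subrr add0r enormZ -/d.
  by rewrite gtr0_norm ?divr_gt0// divfK// gt_eqF.
have Apt (t : R) : 0 < t -> t < 1 -> A (pt t).
  move=> t0 t1; split; last by rewrite /eball /= ptE.
  by apply: cO.2 => //; rewrite divr_gt0.
have Abd x : A x -> `|x - x0| <= 1.
  by move=> [_ /ltW]; apply: le_trans; exact: norm_le_enorm.
(* The ray through [y] contains points of [A] at distances [1 / 4] and [3 / 4] from [x0]. *)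
have diam12 : 1 / 2 <= ediam A.
  apply: ub_le_sup.
    exists (N%:R * 2) => _ [x Ax [z Az <-]].
    apply: le_trans (enorm_le_norm _) _; rewrite ler_wpM2l ?(ltW n0)//.
    rewrite -[x](subrK x0) -addrA (le_trans (ler_normD _ _))//.
    by rewrite (_ : 2 = 1 + 1)// lerD ?Abd// distrC Abd.
  exists (pt (3 / 4)); first by apply: Apt; lra.
  exists (pt (1 / 4)); first by apply: Apt; lra.
  rewrite /pt opprD addrACA subrr add0r -scalerBl enormZ -/d -mulrBl.
  rewrite ger0_norm; last by apply: divr_ge0; [lra|exact: ltW].
  by rewrite divfK ?gt_eqF//; lra.
(* A boundary point exists because [x0 + 2 *: ei] lies outside the unit ball. It makes the infima in
   [edistance] range over a nonempty set and bounds the supremum in [inradius], so neither takes a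
   default value. *)
have [z0 bz0 _] : exists2 z, boundary A z & enorm (pt (1 / 2) - z) <=
    enorm (pt (1 / 2) - (x0 + 2 *: ei)).
  apply: segment_boundary; first by apply: Apt; lra.
  move=> [_]; rewrite /eball /= addrAC subrr add0r; apply/negP; rewrite -leNgt.
  apply: le_trans (norm_le_enorm _).
  by rewrite normrZ nei mulr1 ger0_norm// ler1n.
have edist_ge0 x : lbound [set enorm (x - z) | z in boundary A] 0.
  by move=> _ [z _ <-]; exact: enorm_ge0.
have edist_le x z : boundary A z -> edistance x (boundary A) <= enorm (x - z).
  by move=> bz; apply: ge_inf; [exists 0|exists z].
have inr_ub : has_ubound [set edistance x (boundary A) | x in A].
  exists (N%:R * (1 + `|x0 - z0|)) => _ [x Ax <-].
  apply: le_trans (edist_le _ _ bz0) _; apply: le_trans (enorm_le_norm _) _.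
  rewrite ler_wpM2l ?(ltW n0)// -[x](subrK x0) -addrA.
  by rewrite (le_trans (ler_normD _ _))// lerD2r Abd.
have inr0 : 0 < inradius A.
  (* Chosen with the half-width [(2 N)^-1] below so that the cube around [pt t] is at Euclidean
     distance less than [N (1 / (2 N) + 1 / (4 N)) = 3 / 4] from [x0], hence in the unit ball. *)
  pose t : R := (4 * N%:R)^-1.
  have t0 : 0 < t by rewrite invr_gt0 mulr_gt0.
  have t1 : t < 1 by rewrite invf_lt1 ?mulr_gt0//; lra.
  have At := Apt t t0 t1.
  have /nbhs_ballP[ep /= ep0 epO] := open_nbhs_nbhs (conj oO At.1).
  pose del := Num.min ep (2 * N%:R)^-1.
  have del0 : 0 < del by rewrite lt_min ep0 invr_gt0 mulr_gt0.
  have ballA w : ball (pt t) del w -> A w.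
    move=> bw; split.
      by apply: epO; apply: le_ball bw; rewrite ge_min lexx.
    rewrite /eball /=; apply: le_lt_trans (enorm_le_norm _) _.
    move: bw; rewrite mx_norm_ball /= distrC lt_min => /andP[_ bw].
    apply: (@lt_le_trans _ _ (N%:R * ((2 * N%:R)^-1 + t))).
      rewrite ltr_pM2l// -[w](subrK (pt t)) -addrA.
      apply: le_lt_trans (ler_normD _ _) _; apply: ltr_leD => //.
      by rewrite -[leRHS](ptE t t0); exact: norm_le_enorm.
    rewrite /t (_ : _ * _ = 3 / 4); first lra.
    by field; rewrite gt_eqF.
  apply: (lt_le_trans del0); apply: (@le_trans _ _ (edistance (pt t) (boundary A))).
    apply: lb_le_inf; first by exists (enorm (pt t - z0)); exists z0.
    move=> _ [z [_ nz] <-]; rewrite leNgt; apply/negP => zdel; apply: nz.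
    have bz : ball (pt t) del z.
      by rewrite mx_norm_ball /=; exact: le_lt_trans (norm_le_enorm _) zdel.
    have oB : open (ball (pt t) del) by exact: ball_open.
    by apply: (@filterS _ _ (nbhs_filter z) _ _ ballA); exact: open_nbhs_nbhs.
  by apply: ub_le_sup => //; exists (pt t).
have E0 : 0 < E.
  by rewrite divr_gt0 ?mulr_gt0// (lt_le_trans _ diam12)//; lra.
split => //.
(* Since [ediam A >= 1 / 2], this is at most half the inradius; being strictly below the supremum,
   it is exceeded by the distance to the boundary of an actual point of [A]. *)
pose rho := (8 * E)^-1.
have rhoE : rho = inradius A / (4 * ediam A).
  rewrite /rho /E /eccentricity; field.
  by rewrite !gt_eqF// (lt_le_trans _ diam12)//; lra.
have rho_lt : rho < inradius A.
  rewrite rhoE ltr_pdivrMr; last by lra.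
  by rewrite ltr_pMr//; lra.
have Sne : [set edistance x (boundary A) | x in A] !=set0.
  exists (edistance (pt (1 / 2)) (boundary A)); exists (pt (1 / 2)) => //.
  by apply: Apt; lra.
have [_ [x Ax <-] xrho] := sup_gt Sne rho_lt.
have eA w : enorm (x - w) < rho -> A w.
  move=> xw; apply: contrapT => nAw.
  have [z bz zw] := segment_boundary Ax nAw.
  have := lt_trans (lt_le_trans xrho (edist_le x z bz)) (le_lt_trans zw xw).
  by rewrite ltxx.
(* With this centre, [x0 - h] is close to [x], hence in [A]; membership in [A] yields both the cone
   condition and the bound on [enorm h]. *)
exists (x0 - x) => h; rewrite mx_norm_ball /= => hb.
suff : A (x0 - h).
  by move=> [Oh]; rewrite /eball /= addrAC subrr sub0r enormN.
apply: eA; rewrite -enormN opprB [_ - x]addrAC.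
apply: le_lt_trans (enorm_le_norm _) _.
by rewrite mulrC -ltr_pdivlMr// -invfM.
Qed.

End cones.

(** * Comparison of the norms *)

Section norm_comparison.
Context {R : realType} {N : nat}.
Implicit Types (u v : 'rV[R]_N -> R) (Omega : set 'rV[R]_N).

Local Open Scope ereal_scope.

Lemma measurable_shift_energy u (p : R) : measurable_fun setT u ->
  measurable_fun [set: measurableTypeR R] (shift_energy u p).
Proof.
move=> mu.
have mf : measurable_fun setT
    (fun w : (measurableTypeR R * 'rV[R]_N) * 'rV[R]_N =>
      ((enorm w.2 < w.1.1)%R%:R * `|u (w.1.2 + w.2)%R - u w.1.2| `^ p)%:E).
  apply/measurable_EFinP; apply: measurable_funM.
    by apply: measurable_enorm_lt => //; exact: measurableT_comp.
  by apply: measurable_shift_powR => //; exact: measurableT_comp.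
have f0 (w : (measurableTypeR R * 'rV[R]_N) * 'rV[R]_N) :
    0 <= ((enorm w.2 < w.1.1)%R%:R * `|u (w.1.2 + w.2)%R - u w.1.2| `^ p)%:E.
  by rewrite lee_fin mulr_ge0// powR_ge0.
have mF := @measurable_fun_fubini_tonelli_F _ _ _ _ R (leb N) _ mf f0.
apply: (@measurable_fun_fubini_tonelli_F _ _ _ _ R (leb N) _ mF) => z.
exact: integral_ge0.
Qed.

Lemma K_functional_ge0 (t p : R) Omega u : (0 <= t)%R ->
  0 <= K_functional t p Omega u.
Proof.
move=> t0; apply/ereal_infP => _ [w _ <-].
by rewrite adde_ge0 ?mule_ge0 ?Lnorm_ge0 ?lee_fin.
Qed.

Lemma K_functional_set0 (t p : R) u : (0 < p)%R -> C0infty set0 u ->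
  K_functional t p set0 u <= 0.
Proof.
move=> p0 uC.
apply: (@le_trans _ _ (Lp_norm set0 p (fun x => u x - u x)%R +
    t%:E * Lp_norm set0 p (fun x => enorm (grad u x)))).
  by apply: ereal_inf_lbound; exists u.
have L0 g : Lp_norm set0 p g = 0.
  rewrite /Lp_norm (_ : _ \_ set0 = cst 0); last by apply/funext => x; rewrite patch_set0.
  by rewrite Lnorm0// eqe gt_eqF.
by rewrite !L0 mule0 adde0.
Qed.

(* The junk value [1] only serves the empty cone, where every norm vanishes. *)
Definition eccentricity_radius (E : R) : R :=
  if (0 < E)%R then ((8 * E * N%:R)^-1)%R else 1%R.

Lemma eccentricity_radius_gt0 E : (0 < N)%N -> (0 < eccentricity_radius E)%R.
Proof.
move=> N0; rewrite /eccentricity_radius; case: ifP => // E0.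
by rewrite invr_gt0 !mulr_gt0// ltr0n.
Qed.

(** The cube is found at scale [1] and dilated by [t]: if [h / t] is in it, then [w = x0 - h / t] is
    in [Omega], and [y - h = y + t (w - x0)] stays in [Omega] by [cone_add]. *)
Lemma cone_K_functional_le (x0 : 'rV[R]_N) Omega u (p t : R) :
  (0 < N)%N -> open Omega -> convex_cone x0 Omega -> C0infty Omega u ->
  (1 < p)%R -> (0 < t)%R ->
  K_functional t p Omega u `^ p <=
  (upper_const N p (eccentricity_radius (eccentricity (Omega `&` eball x0 1))) *
    t `^ (- N%:R))%:E * shift_energy u p t.
Proof.
move=> N0 oO cO uC p1 t0; have p0 : (0 < p)%R by exact: lt_trans p1.
set E := eccentricity _; have r0 := eccentricity_radius_gt0 E N0.
have [Om0|/set0P On0] := eqVneq Omega set0.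
  rewrite Om0 in uC *.
  have -> : K_functional t p set0 u = 0.
    by apply/eqP; rewrite eq_le K_functional_set0// K_functional_ge0// ltW.
  rewrite poweR0r ?gt_eqF// mule_ge0 ?shift_energy_ge0// lee_fin.
  by rewrite mulr_ge0 ?powR_ge0// ltW// upper_const_gt0.
have [E0 [c cube]] := open_cone_cube N0 oO cO On0.
rewrite -/E in E0 cube.
have rE : eccentricity_radius E = ((8 * E * N%:R)^-1)%R.
  by rewrite /eccentricity_radius E0.
rewrite -rE in cube; set r := eccentricity_radius E in r0 rE cube *.
have scale (h : 'rV[R]_N) : (`|h - t *: c| < t * r)%R -> ball c r (t^-1 *: h)%R.
  rewrite mx_norm_ball /= => hc.
  rewrite -[c](scalerK (lt0r_neq0 t0)) -scalerBr normrZ gtr0_norm ?invr_gt0//.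
  by rewrite mulrC ltr_pdivrMr// distrC [(r * t)%R]mulrC.
apply: (@K_functional_le _ _ Omega u (t *: c)%R) => //.
  move=> y h Oy hc.
  have [Oh _] : (Omega (x0 - t^-1 *: h) /\ enorm (t^-1 *: h) < 1)%R.
    apply/cube/scale/(le_lt_trans hc).
    by rewrite ltr_pdivrMr// ltr_pMr ?mulr_gt0// ltr1n.
  have := cone_add cO Oy Oh t0.
  rewrite addrAC subrr sub0r scalerN scalerA mulfV ?gt_eqF// scale1r.
  exact.
move=> h; rewrite mx_norm_ball /= distrC => hc.
have [_] := cube _ (scale _ hc).
rewrite enormZ gtr0_norm ?invr_gt0// mulrC ltr_pdivrMr// mul1r.
exact.
Qed.

Lemma X_norm_integrandE (s p t : R) Omega u : (0 < t)%R -> (0 < p)%R ->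
  (K_functional t p Omega u * ((t `^ s)^-1)%:E) `^ p * (t^-1)%:E =
  (t `^ (- (s * p) - 1))%:E * K_functional t p Omega u `^ p.
Proof.
move=> t0 p0; rewrite poweRM ?K_functional_ge0 ?lee_fin ?invr_ge0 ?powR_ge0 ?(ltW t0)//.
rewrite -muleA muleC; congr (_ * _).
rewrite poweR_EFin -EFinM; congr EFin.
rewrite -powRN -powRrM -[X in (_ * X)%R]powR_inv1 ?(ltW t0)// -powRD; last first.
  by rewrite (gt_eqF t0) implybT.
by rewrite mulNr.
Qed.

Lemma X_norm_powR (s p : R) Omega u : (0 < p)%R ->
  X_norm s p Omega u `^ p =
  \int[lebesgue_measure]_(t in `]0%R, +oo[)
    ((t `^ (- (s * p) - 1))%:E * K_functional t p Omega u `^ p).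
Proof.
move=> p0; rewrite /X_norm -poweRrM mulVf ?gt_eqF// poweRe1.
  apply: eq_integral => t; rewrite inE/= in_itv/= andbT => t0.
  exact: X_norm_integrandE.
apply: integral_ge0 => t /=; rewrite in_itv/= andbT => t0.
by rewrite mule_ge0 ?poweR_ge0// lee_fin invr_ge0 ltW.
Qed.

Let weight_energy0 (q : R) u p (t : R) :
  0 <= (t `^ (- q - 1))%:E * shift_energy u p t.
Proof. by rewrite mule_ge0 ?shift_energy_ge0 ?lee_fin ?powR_ge0. Qed.

Let measurable_weight_energy (q : R) u p : measurable_fun setT u ->
  measurable_fun (`]0%R, +oo[%classic : set (measurableTypeR R))
    (fun t : measurableTypeR R => (t `^ (- q - 1))%:E * shift_energy u p t).
Proof.
move=> mu; apply: measurable_funTS; apply: emeasurable_funM.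
  by apply/measurable_EFinP; exact: measurable_powR.
exact: measurable_shift_energy.
Qed.

(** Multiplying the bound on [K] by [t ^ (- s p - 1)] gives the weight of [integral_shift_energy].
    As [N >= 1], the factor [1 / (N + s p)] is at most [1]; this is what makes the constant
    independent of [s]. *)
Lemma X_norm_le_D_norm (c s p : R) Omega u :
  (0 < N)%N -> (1 < p)%R -> (0 < s)%R -> C0infty Omega u -> (0 <= c)%R ->
  (forall t, (0 < t)%R -> K_functional t p Omega u `^ p <=
     (c * t `^ (- N%:R))%:E * shift_energy u p t) ->
  X_norm s p Omega u `^ p <= c%:E * D_norm s p u `^ p.
Proof.
move=> N0 p1 s0 uC c0 KE; have p0 : (0 < p)%R by exact: lt_trans p1.
have mu : measurable_fun setT u by apply: measurable_test_fun; case: uC => ? [].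
pose q := (N%:R + s * p)%R.
have q1 : (1 <= q)%R by rewrite -[leLHS]addr0 lerD ?ler1n// mulr_ge0 ?ltW.
have q0 : (0 < q)%R by exact: lt_le_trans q1.
rewrite X_norm_powR//.
apply: (@le_trans _ _ (\int[lebesgue_measure]_(t in `]0%R, +oo[)
    (c%:E * ((t `^ (- q - 1))%:E * shift_energy u p t)))).
  apply: ge0_le_integral_nonmeasurable => t /=; rewrite in_itv/= andbT => t0.
    by rewrite mule_ge0 ?poweR_ge0// lee_fin powR_ge0.
  rewrite muleA -EFinM; apply: le_trans (lee_wpmul2l _ (KE t t0)) _.
    by rewrite lee_fin powR_ge0.
  rewrite muleA -EFinM le_eqVlt; apply/orP; left; apply/eqP; congr (_%:E * _).
  rewrite mulrCA -powRD; last by rewrite (gt_eqF t0) implybT.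
  by congr (_ * _ `^ _)%R; rewrite /q; ring.
rewrite ge0_integralZl_EFin//; last exact: measurable_weight_energy.
rewrite integral_shift_energy//; apply: lee_wpmul2l; first by rewrite lee_fin.
by rewrite -[leRHS]mul1e lee_wpmul2r ?poweR_ge0// lee_fin invf_le1.
Qed.

(** The factor [N + s p] remains, so this constant depends on [s]; the equivalence of norms is
    stated for fixed [s] and allows it. *)
Lemma D_norm_le_X_norm (s p : R) Omega u :
  (1 < p)%R -> (0 < s)%R -> C0infty Omega u ->
  D_norm s p u `^ p <=
  ((N%:R + s * p) * @lower_const R N p)%:E * X_norm s p Omega u `^ p.
Proof.
move=> p1 s0 uC; have p0 : (0 < p)%R by exact: lt_trans p1.
have mu : measurable_fun setT u by apply: measurable_test_fun; case: uC => ? [].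
pose q := (N%:R + s * p)%R.
have q0 : (0 < q)%R by rewrite ltr_wpDl// mulr_gt0.
have l0 := @lower_const_gt0 R N p; set l := lower_const p in l0 *.
suff H : l^-1%:E * (q^-1%:E * D_norm s p u `^ p) <= X_norm s p Omega u `^ p.
  rewrite mulrC EFinM -/q.
  apply: le_trans (lee_wpmul2l _ H); last by rewrite lee_fin mulr_ge0 ?ltW.
  by rewrite !muleA -!EFinM -mulrA mulrCA !mulfK
    ?mulVf ?mulfV ?gt_eqF// ?mul1e ?mulr1.
rewrite X_norm_powR// -integral_shift_energy// -ge0_integralZl_EFin//; last 2 first.
  exact: measurable_weight_energy.
  by rewrite invr_ge0 ltW.
apply: ge0_le_integral_nonmeasurable => t /=; rewrite in_itv/= andbT => t0.
  by rewrite mule_ge0 ?weight_energy0// lee_fin invr_ge0 ltW.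
rewrite muleA -EFinM.
apply: le_trans (lee_wpmul2l _ (shift_energy_le_K uC p1 t0)) _.
  by rewrite lee_fin mulr_ge0 ?powR_ge0// invr_ge0 ltW.
rewrite muleA -EFinM le_eqVlt; apply/orP; left; apply/eqP; congr (_%:E * _).
rewrite -/l -[(t ^+ N)%R]powR_mulrn ?(ltW t0)//.
rewrite mulrACA [(l^-1 * l)%R]mulVf ?gt_eqF// mul1r -powRD; last first.
  by rewrite (gt_eqF t0) implybT.
by congr (_ `^ _)%R; rewrite /q; ring.
Qed.

End norm_comparison.

Theorem corollary4p8 (R : realType) :
  exists C : nat -> R -> R -> R,
  forall (N : nat) (p s : R) (x0 : 'rV[R]_N) (Omega : set 'rV[R]_N),
    (0 < N)%N -> 1 < p -> 0 < s -> s < 1 ->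
    open Omega -> convex_cone x0 Omega ->
    let c := C N p (eccentricity (Omega `&` eball x0 1)) in
    0 < c /\
    (forall u, C0infty Omega u ->
       (X_norm s p Omega u `^ p <= c%:E * D_norm s p u `^ p)%E) /\
    equivalent_norms (C0infty Omega) (X_norm s p Omega) (D_norm s p).
Proof.
exists (fun N p E => upper_const N p (@eccentricity_radius R N E)).
move=> N p s x0 Omega N0 p1 s0 _ oO cO c.
have p0 : 0 < p by exact: lt_trans p1.
have c0 : 0 < c by rewrite upper_const_gt0// eccentricity_radius_gt0.
have XD u : C0infty Omega u -> (X_norm s p Omega u `^ p <= c%:E * D_norm s p u `^ p)%E.
  move=> uC; apply: X_norm_le_D_norm => //; first exact: ltW.
  by move=> t t0; exact: cone_K_functional_le.
split => //; split => //.
set l := (N%:R + s * p) * @lower_const R N p.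
have l0 : 0 < l by rewrite mulr_gt0 ?lower_const_gt0// ltr_wpDl// mulr_gt0.
(* Extraction of [p]-th roots in the extended reals, so that finiteness of the norms is never at
   issue. *)
have root (x y : \bar R) (a : R) : 0 < a -> (0 <= x)%E -> (0 <= y)%E ->
    (x `^ p <= a%:E * y `^ p)%E -> (x <= (a `^ p^-1)%:E * y)%E.
  move=> a0 x0' y0 h.
  have pV : p * p^-1 = 1 by rewrite mulfV// gt_eqF.
  have ay0 : (0 <= a%:E * y `^ p)%E by rewrite mule_ge0 ?poweR_ge0// lee_fin ltW.
  have pV0 : 0 <= p^-1 by rewrite invr_ge0 ltW.
  rewrite -[leLHS]poweRe1// -pV poweRrM -[y in leRHS]poweRe1// -pV [(y `^ _)%E]poweRrM.
  rewrite -poweR_EFin -poweRM ?poweR_ge0 ?lee_fin ?(ltW a0)//.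
  by apply: gt0_ler_poweR; rewrite ?in_itv/= ?leey ?andbT ?poweR_ge0.
have X0 u : (0 <= X_norm s p Omega u)%E by exact: poweR_ge0.
have D0 (u : 'rV[R]_N -> R) : (0 <= D_norm s p u)%E by exact: poweR_ge0.
exists (l `^ p^-1)^-1, (c `^ p^-1); split; first by rewrite invr_gt0 powR_gt0.
split; first by rewrite powR_gt0.
move=> u uC; split; last by apply: root => //; exact: XD.
have /root : (D_norm s p u `^ p <= l%:E * X_norm s p Omega u `^ p)%E.
  exact: D_norm_le_X_norm.
move=> /(_ l0 (D0 u) (X0 u)) H.
apply: le_trans (lee_wpmul2l _ H) _; first by rewrite lee_fin invr_ge0 powR_ge0.
by rewrite muleA -EFinM mulVf ?mul1e// gt_eqF// powR_gt0.
Qed.
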